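(* Let $K=\sum_{n\ge0}\kappa_n\otimes(e_n\otimes e_n^* )$, an $\mathcal{L}(\ell^2)$-valued kernel on the Cantor group $G$. The operator $f\mapsto \mathrm{P.V.}(K*f)$ coincides, for $f\in L^2(G,\ell^2)$, with the orthogonal projection $P:L^2(G,\ell^2)\to\iota(H^2(\delta))$, and for $f\in L^1(G,\ell^2)$ the principal value exists almost everywhere and defines a bounded operator $L^1(G,\ell^2)\to L^{1,\infty}(G,\ell^2)$ (hence a bounded operator $L^p(G,\ell^2)\to L^p(G,\ell^2)$ for every $1<p<\infty$).
   Context: $G=\mathbb{Z}_2^{\mathbb{N}^+}$ (elements $x=(x_1,x_2,\dots)$, $x_k\in\{0,1\}$, identified with subsets of $\mathbb{N}^+$, $\emptyset$ the identity), with Haar probability measure $\mu$, coordinatewise addition mod 2, and metric $d(x,y)=2^{-\min\{k:x_k\ne y_k\}}$ (with $\min\emptyset=\infty$); $\min x=\min\{k:x_k=1\}$. For finite $A\subset\mathbb{N}^+$, $w_A(x)=(-1)^{\sum_{k\in A}x_k}$, with $\max\emptyset=0$. $\mathcal{F}_n$ is the $\sigma$-algebra generated by $x_1,\dots,x_n$, $\mathbb{E}_n$ its conditional expectation, $\Delta_0=\mathbb{E}_0$, $\Delta_n=\mathbb{E}_n-\mathbb{E}_{n-1}$ ($n\ge1$); $\Delta_nf=\sum_{\max A=n}\langle f,w_A\rangle w_A$. Set $\kappa_n=\sum_{\max A=n}w_A$; explicitly $\kappa_0\equiv1$ and for $n\ge1$: $\kappa_n(x)=2^{n-1}$ if $n<\min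 x$, $-2^{n-1}$ if $n=\min x$, $0$ if $n>\min x$, so $\Delta_n f=\kappa_n*f$. $(e_n)_{n\ge0}$ is the unit vector basis of $\ell^2$ and $e_n^*$ the $n$-th coordinate functional. Convolution: $(K*f)(x)=\int_G K(y)f(x-y)\,d\mu(y)$, and $\mathrm{P.V.}(K*f)(x)=\lim_{r\to0}\int_{G\setminus B(\emptyset,r)}K(y)f(x-y)\,d\mu(y)$. $\iota(H^2(\delta))=\{(f_n)_{n\ge0}\in L^2(G,\ell^2):\Delta_nf_n=f_n\ \forall n\}$ (the $L^2(\ell^2)$-closed span of $w_A\otimes e_{\max A}$). $L^{1,\infty}(G,\ell^2)$ is weak $L^1$ with quasinorm $\sup_{\lambda>0}\lambda\mu\{\|g\|_{\ell^2}>\lambda\}$. *)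

(* Defs.v *)
From HB Require Import structures.
From mathcomp Require Import all_boot all_order all_algebra.
From mathcomp Require Import all_classical all_reals all_analysis.
Set Implicit Arguments. Unset Strict Implicit. Unset Printing Implicit Defensive.
Import Order.TTheory GRing.Theory Num.Theory.
Import numFieldNormedType.Exports.
Local Open Scope classical_set_scope.
Local Open Scope ring_scope.

(* The Cantor group G = Z_2^{N^+}.  An element is x : nat -> bool where the
   paper's coordinate x_k (k >= 1) is  x (k - 1)  (0-based storage). *)
Definition Gset := nat -> bool.

Definition cylinders : set (set Gset) :=
  [set A | exists (i : nat) (b : bool), A = [set x | x i = b]].

(* G as a measurable space (Borel sigma-algebra = sigma-algebra generated by
   the cylinders). *)
Definition G : Type := g_sigma_algebraType cylinders.
Definition Gdisp := cylinders.-sigma%mdisp.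

(* group law (coordinatewise addition mod 2); note x - y = x + y *)
Definition addG (x y : G) : G := fun k => xorb (x k) (y k).
Definition emptyG : G := fun _ => false.

(* min x = min {k >= 1 : x_k = 1} (None encodes min emptyset = infinity) *)
Definition minG (x : G) : option nat :=
  match pselect (exists i, x i) with
  | left H => Some (@ex_minn (fun i => x i) H).+1
  | right _ => None
  end.

Section WithR.
Variable R : realType.

Definition dG (x y : G) : R :=
  match minG (addG x y) with
  | Some m => (2 ^+ m)^-1
  | None => 0
  end.

Definition ballG (c : G) (r : R) : set G := [set y | dG c y < r].

Definition kappa (n : nat) (x : G) : R :=
  match n with
  | 0 => 1
  | n'.+1 =>
      match minG x with
      | None => 2 ^+ n'
      | Some m => if (n < m)%N then 2 ^+ n'
                  else if n == m then - 2 ^+ n' else 0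
      end
  end.

Definition l2sq (v : nat -> R) : \bar R :=
  (\sum_(0 <= n <oo) ((v n) ^+ 2)%:E)%E.

Definition is_l2 (v : nat -> R) : Prop := (l2sq v < +oo)%E.

Definition normV (v : nat -> R) : \bar R :=
  match l2sq v with
  | r%:E => (Num.sqrt r)%:E
  | _ => +oo%E
  end.

Variable mu : {measure set G -> \bar R}.

(* (strong = weak, l^2 being separable) measurability of f : G -> l^2 *)
Definition measV (f : G -> nat -> R) : Prop :=
  forall n, measurable_fun setT (fun x => f x n).

Definition LpnormV (p : R) (f : G -> nat -> R) : \bar R :=
  ((\int[mu]_x (normV (f x) `^ p)) `^ p^-1)%E.

Definition LpV (p : R) (f : G -> nat -> R) : Prop :=
  measV f /\ (LpnormV p f < +oo)%E.

Definition innerV (f g : G -> nat -> R) : \bar R :=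
  (\int[mu]_x (\sum_(0 <= n <oo) ((f x n) * (g x n))%:E))%E.

Definition convG (k h : G -> R) (x : G) : R :=
  fine (\int[mu]_y ((k y) * h (addG x y))%:E)%E.

(* iota(H^2(delta)) = {(f_n) in L^2(G,l^2) : Delta_n f_n = f_n for all n},
   with Delta_n h = kappa_n * h *)
Definition H2delta : set (G -> nat -> R) :=
  [set g | LpV 2 g /\
           forall n, {ae mu, forall x, convG (kappa n) (fun y => g y n) x = g x n}].

(* truncated integral  int_{G \ B(emptyset, r)} K(y) f(x - y) dmu(y),
   computed componentwise: (K(y) v)_n = kappa_n(y) v_n *)
Definition truncK (f : G -> nat -> R) (x : G) (r : R) : nat -> R :=
  fun n => fine (\int[mu]_(y in ~` ballG emptyG r)
                   ((kappa n y) * f (addG x y) n)%:E)%E.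

Definition PVlim (f : G -> nat -> R) (x : G) (v : nat -> R) : Prop :=
  is_l2 v /\
  ((fun r => l2sq (fun n => truncK f x r n - v n)) @ 0^'+ --> 0%E).

Definition PVexists (f : G -> nat -> R) (x : G) : Prop := exists v, PVlim f x v.

(* P.V.(K * f)(x), set to 0 where the principal value does not exist *)
Definition PVK (f : G -> nat -> R) (x : G) : nat -> R :=
  match pselect (PVexists f x) with
  | left H => projT1 (cid H)
  | right _ => fun _ => 0
  end.

Definition weakL1V (g : G -> nat -> R) : \bar R :=
  ereal_sup [set (lam%:E * mu [set x | (lam%:E < normV (g x))%E])%E
            | lam in [set lam : R | 0 < lam]].

End WithR.

(* Main.v *)
(** Write [E_n] for the average over the [n]-th dyadic cylinder.  The truncated
    integral at scale [2^-N] has [n]-th coordinate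
    [Delta_n f_n - w_n 2^-N E_N f_n] for [n <= N] and [0] for [n > N], with
    [w_0 = 1], [w_n = 2^(n-1)], so the principal value can only be
    [T f = (Delta_n f_n)_n].

    [|T f|] is dominated pointwise by the square function [S] of the
    [l^2]-valued dyadic martingale [E_n f].  A function [U] with
    [U(v+d, y+|d|^2) + U(v-d, y+|d|^2) <= 2 U(v, y)] makes
    [U(E_n f, S_n^2)] a supermartingale; the choice
    [U = y - |v|^2] where [|v| + sqrt y < l], [U = l^2 - 2 l |v|] elsewhere,
    gives the weak type (1,1), and [U = y^q - q y^(q-1) |v|^2] gives [L^(2q)]
    for [q >= 1].  The range [1 < p < 2] follows by duality, [T] being
    self-adjoint.

    The error terms [w_n 2^-N E_N f_n] tend to [0] in [l^2] almost
    everywhere: finitely many coordinates do so everywhere, because the integral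
    over a shrinking cylinder tends to [0], and those with [n >= M] are bounded
    by the dyadic maximal function of the norm of the tail [(f_n)_(n >= M)],
    whose [L^1] norm tends to [0] with [M]. *)
Require Import Defs.
From HB Require Import structures.
From mathcomp Require Import all_boot all_order all_algebra.
From mathcomp Require Import all_classical all_reals all_analysis.
From mathcomp Require Import measurable_realfun ring lra.
Import Order.TTheory GRing.Theory Num.Theory.
Import numFieldNormedType.Exports.
Set Implicit Arguments.
Unset Strict Implicit.
Unset Printing Implicit Defensive.
Local Open Scope classical_set_scope.
Local Open Scope ring_scope.

Local Notation seg n := (index_iota 0 n).

(** * Powers, limits and integration *)

Section powers_and_limits.
Variable R : realType.

Lemma powR_ge_tangent (q a b : R) : 1 <= q -> 0 <= a -> 0 <= b ->
  b `^ q + q * b `^ (q - 1) * (a - b) <= a `^ q.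
Proof.
rewrite le_eqVlt => /predU1P[<-|q1] a0 b0.
  by rewrite subrr powRr0 !mul1r !powRr1// addrC subrK.
have q0 : 0 < q by rewrite (lt_trans ltr01).
have q10 : 0 < q - 1 by rewrite subr_gt0.
have conj_q : q^-1 + (q / (q - 1))^-1 = 1.
  by rewrite invf_div -{1}[q^-1]mul1r -mulrDl addrC subrK mulfV// gt_eqF.
have := conjugate_powR a0 (powR_ge0 b (q - 1)) q0 (divr_gt0 q0 q10) conj_q.
rewrite -powRrM [(q - 1) * _]mulrC divfK ?gt_eqF// => young.
have : q * (a * b `^ (q - 1)) <= a `^ q + (q - 1) * b `^ q.
  rewrite mulrC -ler_pdivlMr// (le_trans young)// le_eqVlt; apply/orP; left.
  by apply/eqP; field; rewrite !gt_eqF.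
by rewrite mulrBr -[_ * b]mulrA [_ `^ _ * b]mulrC mulr_powRB1//; lra.
Qed.

Lemma powR_young (p q e : R) : 0 < p -> 0 < q -> p^-1 + q^-1 = 1 -> 0 < e ->
  exists2 K, 0 < K & forall a b : R, 0 <= a -> 0 <= b ->
    a * b <= K * a `^ p + e * b `^ q.
Proof.
move=> p0 q0 conj_pq e0; pose t := (e * q) `^ q^-1.
have t0 : 0 < t by rewrite powR_gt0// mulr_gt0.
exists (t^-1 `^ p / p) => [|a b a0 b0].
  by rewrite divr_gt0// powR_gt0// invr_gt0.
have -> : a * b = (t^-1 * a) * (t * b) by field; rewrite gt_eqF.
have ta0 : 0 <= t^-1 * a by rewrite mulr_ge0// invr_ge0 ltW.
have tb0 : 0 <= t * b by rewrite mulr_ge0// ltW.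
apply: le_trans (conjugate_powR ta0 tb0 p0 q0 conj_pq) _.
have tq : t `^ q = e * q.
  by rewrite -powRrM mulVf ?gt_eqF// powRr1// ltW// mulr_gt0.
rewrite !powRM ?invr_ge0 ?(ltW t0)// tq le_eqVlt; apply/orP; left.
by apply/eqP; field; rewrite !gt_eqF.
Qed.

Lemma lee_poweR2r (r : R) (x y : \bar R) : 0 <= r -> (0 <= x)%E ->
  (x <= y)%E -> (x `^ r <= y `^ r)%E.
Proof.
move=> r0 x0 xy; apply: gt0_ler_poweR => //; rewrite in_itv/= ?leey ?andbT//.
exact: le_trans xy.
Qed.

Lemma lee_poweR_root (r : R) (x y : \bar R) : 0 < r -> (0 <= x)%E ->
  (x `^ r <= y)%E -> (x <= y `^ r^-1)%E.
Proof.
move=> r0 x0 xy; rewrite -[leLHS](poweRe1 x0) -(mulfV (lt0r_neq0 r0)) poweRrM.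
by apply: lee_poweR2r xy; rewrite ?invr_ge0 ?poweR_ge0// ltW.
Qed.

Lemma lee_1D_poweR (x : \bar R) (p : R) : 1 <= p -> (0 <= x)%E ->
  (x <= 1 + x `^ p)%E.
Proof.
move=> p1; case: x => [r| |]// r0; last first.
  by rewrite poweRyr ?gt_eqF// (lt_le_trans _ p1).
rewrite poweR_EFin -EFinD !lee_fin in r0 *.
have [r1|/ltW r1] := leP r 1; first by rewrite ler_wpDr ?powR_ge0.
by rewrite ler_wpDl// le1r_powR.
Qed.

Lemma ge0_cvge0P (T : Type) (F : set_system T) (FF : Filter F)
    (u : T -> \bar R) : (forall x, 0 <= u x)%E ->
  u @ F --> 0%E <->
  (forall e : R, 0 < e -> \forall x \near F, (u x <= e%:E)%E).
Proof.
move=> u0; split=> [cvg_u e|small].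
  by rewrite -lte_fin => /open_ereal_lt'/cvg_u; apply: (@filterS _ F) => x /ltW.
move=> A [e /= e0 ballA]; have e2 : 0 < e / 2 by rewrite divr_gt0.
apply: filterS (small _ e2) => x; have := u0 x.
case ux : (u x) => [r| |]//; rewrite !lee_fin => r0 re.
rewrite /= ux; apply: ballA; rewrite /= sub0r normrN ger0_norm//.
lra.
Qed.

Lemma cvgn_series_abs_bounded (u : nat -> R) (M : R) :
  (forall N, \sum_(0 <= n < N) `|u n| <= M) -> cvgn (series u).
Proof.
move=> uM; apply: normed_cvg; apply: nondecreasing_is_cvgn.
  by apply: nondecreasing_series => n _ _; exact: normr_ge0.
by exists M => _ [N _ <-]; exact: uM.
Qed.

Lemma cvg_invr_exp2 : (fun N : nat => (2 ^+ N)^-1 : R) @ \oo --> (0 : R).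
Proof.
under eq_fun do rewrite -exprVn -[_ ^+ _]mul1r.
by apply: cvg_geometric; rewrite ger0_norm// invf_lt1// ltr1n.
Qed.

Lemma conjugate_exponent (p q : R) : 1 < p -> p^-1 + q^-1 = 1 ->
  0 < q /\ (p - 1) * q = p.
Proof.
move=> p1 conj_pq; have p0 : 0 < p by lra.
have p_inv_lt1 : p^-1 < 1 by rewrite invf_lt1.
have q0 : 0 < q by rewrite -invr_gt0; lra.
split => //; have : q = (p^-1 + q^-1) * (p * q) - p.
  by field; rewrite !gt_eqF.
by rewrite conj_pq; lra.
Qed.

End powers_and_limits.

Section integration.
Context d (T : measurableType d) (R : realType).
Variable mu : {measure set T -> \bar R}.
Implicit Types (h k b : T -> R) (A B : set T).

Local Notation L1 h := (mu.-integrable setT (EFin \o h)).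

Lemma integrable_measurable h : L1 h -> measurable_fun setT h.
Proof. by move=> /measurable_int /measurable_EFinP. Qed.

Lemma integrableZl_EFin (c : R) h : L1 h -> L1 (fun x => c * h x).
Proof. exact: (@integrableZl _ _ _ _ _ measurableT c (EFin \o h)). Qed.

Lemma integrableD_EFin h k : L1 h -> L1 k -> L1 (fun x => h x + k x).
Proof. by move=> hi ki; exact: (integrableD measurableT hi ki). Qed.

Lemma integrableB_EFin h k : L1 h -> L1 k -> L1 (fun x => h x - k x).
Proof. by move=> hi ki; exact: (integrableB measurableT hi ki). Qed.

Lemma integrable_sum_EFin (I : Type) (s : seq I) (h : I -> T -> R) :
  (forall i, L1 (h i)) -> L1 (fun x => \sum_(i <- s) h i x).
Proof.
move=> hi; rewrite (_ : EFin \o _ = fun x => \sum_(i <- s) (h i x)%:E)%E.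
  by apply: integrable_sum => // i _; exact: hi.
by apply/funext => x; rewrite /= sumEFin.
Qed.

Lemma Rintegral_sum (I : Type) (s : seq I) (h : I -> T -> R) :
  (forall i, L1 (h i)) ->
  \int[mu]_x (\sum_(i <- s) h i x) = \sum_(i <- s) \int[mu]_x h i x.
Proof.
move=> hi; elim: s => [|i s ih].
  under eq_Rintegral do rewrite big_nil.
  by rewrite /Rintegral integral0 big_nil.
under eq_Rintegral do rewrite big_cons.
by rewrite big_cons -ih RintegralD//; exact: integrable_sum_EFin.
Qed.

Lemma le_integrable_EFin h k : measurable_fun setT h ->
  (forall x, `|h x| <= k x) -> L1 k -> L1 h.
Proof.
move=> mh hk; apply: le_integrable => //; first exact/measurable_EFinP.
by move=> x _; rewrite lee_fin (le_trans (hk x))// ler_norm.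
Qed.

Lemma integrableM_bounded h b (M : R) : L1 h -> measurable_fun setT b ->
  (forall x, `|b x| <= M) -> L1 (fun x => h x * b x).
Proof.
move=> hi mb bM; have := integrableZl_EFin M (integrable_norm hi).
apply: le_integrable_EFin => [|x]; last by rewrite normrM mulrC ler_wpM2r.
exact: measurable_funM (integrable_measurable hi) mb.
Qed.

Lemma integrable_indicM A h : measurable A -> L1 h ->
  L1 (fun x => \1_A x * h x).
Proof.
move=> mA hi; rewrite (_ : (fun x => _) = fun x => h x * \1_A x).
  apply: (integrableM_bounded (M := 1)) => // x.
  by rewrite indicE; case: (_ \in _); rewrite ?normr1 ?normr0.
by apply/funext => x; rewrite mulrC.
Qed.

Lemma indic_pred (P : T -> bool) x : \1_[set x | P x] x = (P x)%:R :> R.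
Proof.
by rewrite indicE; congr (_%:R); apply: congr1; apply/idP/idP; rewrite inE.
Qed.

Lemma Rintegral_indicM A h :
  \int[mu]_x (\1_A x * h x) = \int[mu]_(x in A) h x.
Proof.
rewrite [RHS]Rintegral_mkcond patch_indic.
by under eq_Rintegral do rewrite mulrC.
Qed.

Lemma EFin_Rintegral h : L1 h -> (\int[mu]_x h x)%:E = (\int[mu]_x (h x)%:E)%E.
Proof. by move=> hi; rewrite /Rintegral fineK// integrable_fin_num. Qed.

Lemma ge0_integrableP (u : T -> \bar R) : (forall x, 0 <= u x)%E ->
  mu.-integrable setT u <->
  measurable_fun setT u /\ (\int[mu]_x u x < +oo)%E.
Proof.
move=> u0; have abs_u : (\int[mu]_x `|u x| = \int[mu]_x u x)%E.
  by apply: eq_integral => x _; rewrite gee0_abs.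
by split=> [/integrableP|] [meas_u u_oo]; [|apply/integrableP];
  split=> //; rewrite ?abs_u// -abs_u.
Qed.

Lemma subset_le_measure A B : measurable A -> measurable B -> A `<=` B ->
  (mu A <= mu B)%E.
Proof. by move=> mA mB AB; apply: le_measure; rewrite ?inE. Qed.

Lemma measure_bigcup_le (F : nat -> set T) (c : \bar R) :
  (forall n, measurable (F n)) -> (forall n, F n `<=` F n.+1) ->
  (forall n, mu (F n) <= c)%E -> (mu (\bigcup_n F n) <= c)%E.
Proof.
move=> mF FS Fc.
have ndF : {homo F : n m / (n <= m)%N >-> (n <= m)%O}.
  by apply/nondecreasing_seqP => n; apply/subsetPset; exact: FS.
have mUF := bigcup_measurable (fun n (_ : setT n) => mF n).
have := nondecreasing_cvg_mu (mu := mu) mF mUF ndF.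
move=> /cvg_lim <-//.
apply: lime_le; last by exists 0%N => // n _; exact: Fc.
apply: ereal_nondecreasing_is_cvgn => m n mn.
by apply: subset_le_measure => //; apply/subsetPset; exact: ndF.
Qed.

Lemma weak_type_ae_lty (u : T -> \bar R) (K : R) : measurable_fun setT u ->
  (forall l : R, 0 < l ->
    (l%:E * mu [set x | (l%:E < u x)%E] <= K%:E)%E) ->
  {ae mu, forall x, (u x < +oo)%E}.
Proof.
move=> meas_u weak_u; pose A := [set x | u x = +oo%E].
have mA : measurable A.
  by rewrite -[A]setTI; exact: (meas_u measurableT _ (emeasurable_set1 _)).
apply: (@negligibleS _ _ _ mu A) => [x /= /negP|].
  by rewrite ltey negbK => /eqP.
apply/negligibleP => //; apply/eqP; rewrite eq_le measure_ge0 andbT.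
apply/lee_addgt0Pr => e e0; rewrite add0e.
have l0 : 0 < (`|K| + 1) / e by rewrite divr_gt0// ltr_wpDl.
rewrite -(@lee_pmul2l _ ((`|K| + 1) / e)%:E)// -EFinM divfK ?gt_eqF//.
apply: (@le_trans _ _ K%:E); last first.
  by rewrite lee_fin (le_trans (ler_norm K))// lerDl.
apply: le_trans (weak_u _ l0); rewrite lee_pmul2l//.
apply: subset_le_measure => //.
- by rewrite -[X in measurable X]setTI; exact: emeasurable_fun_o_infty.
- by move=> x /= ->; rewrite ltry.
Qed.

Lemma measurable_fun_limn_einf (u : nat -> T -> \bar R) :
  (forall n, measurable_fun setT (u n)) ->
  measurable_fun setT (fun x => limn_einf (u^~ x)).
Proof.
move=> meas_u; apply: measurableT_comp => //.
apply: (@measurable_fun_limn_esup _ _ _ _ (fun n x => - u n x)%E) => n.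
exact: measurableT_comp.
Qed.

Lemma cvgn_limn_esup (u : nat -> \bar R) :
  (limn_esup u <= limn_einf u)%E -> u @ \oo --> limn_esup u.
Proof.
move=> sup_inf; have inf_sup : limn_einf u = limn_esup u.
  by apply/eqP; rewrite eq_le limn_einf_sup.
apply: (@squeeze_cvge _ _ _ _ (einfs u) _ (esups u)).
- apply: nearW => n; apply/andP; split.
    by apply: ereal_inf_lbound; exists n => /=.
  by apply: ereal_sup_ubound; exists n => /=.
- by rewrite -inf_sup limn_einf_lim; exact: is_cvg_einfs.
- by rewrite limn_esup_lim; exact: is_cvg_esups.
Qed.

(* [limn] of a divergent sequence is the junk value [point], so the limit is
   measurable without assuming convergence anywhere. *)
Lemma measurable_fun_limn (u : nat -> T -> \bar R) :
  (forall n, measurable_fun setT (u n)) ->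
  measurable_fun setT (fun x => limn (u^~ x)).
Proof.
move=> meas_u; have msup := measurable_fun_limn_esup meas_u.
have minf := measurable_fun_limn_einf meas_u.
rewrite (_ : (fun x => limn (u^~ x)) = fun x =>
    if (limn_esup (u^~ x) <= limn_einf (u^~ x))%E then limn_esup (u^~ x)
    else point).
  by apply: measurable_fun_ifT => //; exact: measurable_fun_lee.
apply/funext => x; case: ifPn => [|/negP not_le].
  by move=> /cvgn_limn_esup/cvg_lim; exact.
apply: dvgP => cvg_u; apply: not_le.
by rewrite is_cvg_limn_esupE// is_cvg_limn_einfE.
Qed.

Lemma ge0_integral_limn_le (u : nat -> T -> \bar R) (c : \bar R) :
  (forall n, measurable_fun setT (u n)) -> (forall n x, 0 <= u n x)%E ->
  (forall x, {homo u^~ x : m n / (m <= n)%N >-> (m <= n)%E}) ->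
  (forall n, \int[mu]_x u n x <= c)%E -> (\int[mu]_x limn (u^~ x) <= c)%E.
Proof.
move=> meas_u u0 nd_u uc.
have cvg_int := cvg_monotone_convergence (mu := mu) measurableT meas_u
  (fun n x _ => u0 n x) (fun x _ => nd_u x).
rewrite -(cvg_lim _ cvg_int)//; apply: lime_le; last exact: nearW.
by apply/cvg_ex; eexists; exact: cvg_int.
Qed.

Lemma integral_eseries_eq0 (F : nat -> T -> R) (D : T -> \bar R) :
  (forall n, measurable_fun setT (F n)) -> mu.-integrable setT D ->
  (forall N x, (\sum_(0 <= n < N) `|F n x|)%:E <= D x)%E ->
  (forall n, \int[mu]_x (F n x)%:E = 0)%E ->
  (\int[mu]_x (\sum_(0 <= n <oo) (F n x)%:E) = 0)%E.
Proof.
move=> mF iD FD F0; pose S N x := (\sum_(0 <= n < N) (F n x)%:E)%E.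
have D0 x : (0 <= D x)%E by have := FD 0%N x; rewrite big_geq.
have mS N : measurable_fun setT (S N).
  by apply: emeasurable_sum => n; apply/measurable_EFinP; exact: mF.
have SD N x : (`|S N x| <= D x)%E.
  by apply: le_trans (FD N x); rewrite /S sumEFin lee_fin ler_norm_sum.
have cvgS : {ae mu, forall x, [set: T] x -> S^~ x @ \oo --> limn (S^~ x)}.
  have := integrable_ae measurableT iD; apply: filterS => x /(_ I) Dx _.
  have -> : S^~ x = EFin \o series (F^~ x).
    by apply/funext => N; rewrite /S sumEFin.
  apply/cvg_ex; exists (limn (series (F^~ x)))%:E.
  apply: cvg_EFin; first exact: nearW.
  apply: (@cvgn_series_abs_bounded _ _ (fine (D x))) => N.
  by rewrite -lee_fin fineK//; exact: FD.
have boundS : {ae mu, forall x N, [set: T] x -> (`|S N x| <= D x)%E}.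
  by apply: aeW => x N _; exact: SD.
have [_ _] :=
  dominated_convergence measurableT mS (measurable_fun_limn mS) cvgS iD boundS.
have intS N : (\int[mu]_x S N x = 0)%E.
  rewrite integral_sum//; first by rewrite big1.
  move=> n; apply: le_integrable iD => //; first exact/measurable_EFinP.
  move=> x _; rewrite [leRHS]gee0_abs//; apply: le_trans (FD n.+1 x).
  by rewrite lee_fin big_nat_recr//= lerDr sumr_ge0.
under [X in X @ _]eq_fun do rewrite intS.
move=> /(cvg_lim (@ereal_hausdorff R)) <-.
by rewrite lim_cst//; exact: ereal_hausdorff.
Qed.

End integration.

(** * Euclidean norms and special functions *)

Section finite_euclidean_norm.
Variables (R : rcfType) (I : Type).
Implicit Types (s : seq I) (u v w : I -> R).

Definition sqnorm s v : R := \sum_(i <- s) v i ^+ 2.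

Definition norm2 s v : R := Num.sqrt (sqnorm s v).

Lemma sqnorm_ge0 s v : 0 <= sqnorm s v.
Proof. by apply: sumr_ge0 => i _; exact: sqr_ge0. Qed.
#[local] Hint Resolve sqnorm_ge0 : core.

Lemma norm2_ge0 s v : 0 <= norm2 s v.
Proof. exact: sqrtr_ge0. Qed.
#[local] Hint Resolve norm2_ge0 : core.

Lemma sqr_norm2 s v : norm2 s v ^+ 2 = sqnorm s v.
Proof. by rewrite sqr_sqrtr. Qed.

Lemma norm2_le_sqr s v (a : R) : 0 <= a ->
  (norm2 s v <= a) = (sqnorm s v <= a ^+ 2).
Proof. by move=> a0; rewrite -sqr_norm2 ler_sqr ?nnegrE. Qed.

Lemma sqnorm_cons i s v : sqnorm (i :: s) v = v i ^+ 2 + sqnorm s v.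
Proof. by rewrite /sqnorm big_cons. Qed.

Lemma sqnorm_nil v : sqnorm [::] v = 0.
Proof. by rewrite /sqnorm big_nil. Qed.

Lemma sqnormN s v : sqnorm s (fun i => - v i) = sqnorm s v.
Proof. by apply: eq_bigr => i _; rewrite sqrrN. Qed.

Lemma parallelogram s u w : sqnorm s (fun i => u i + w i) +
  sqnorm s (fun i => u i - w i) = 2 * (sqnorm s u + sqnorm s w).
Proof.
rewrite /sqnorm -!big_split /= mulr_sumr; apply: eq_bigr => i _; ring.
Qed.

Lemma cauchy_schwarz s u v : \sum_(i <- s) u i * v i <= norm2 s u * norm2 s v.
Proof.
elim: s => [|i s ih].
  by rewrite big_nil mulr_ge0.
rewrite big_cons; apply: le_trans (lerD (lexx _) ih) _.
rewrite -[leRHS]ger0_norm ?mulr_ge0// -sqrtr_sqr.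
apply: le_trans (ler_norm _) _; rewrite -sqrtr_sqr ler_wsqrtr//.
rewrite exprMn !sqr_norm2 !sqnorm_cons -!sqr_norm2 -subr_ge0.
rewrite (_ : _ - _ = (u i * norm2 s v - v i * norm2 s u) ^+ 2) ?sqr_ge0//.
ring.
Qed.

Lemma norm2D s u w : norm2 s (fun i => u i + w i) <= norm2 s u + norm2 s w.
Proof.
rewrite norm2_le_sqr ?addr_ge0//.
have -> : sqnorm s (fun i => u i + w i) =
    sqnorm s u + 2 * (\sum_(i <- s) u i * w i) + sqnorm s w.
  by rewrite /sqnorm mulr_sumr -!big_split /=; apply: eq_bigr => i _; ring.
by rewrite sqrrD !sqr_norm2; have := cauchy_schwarz s u w; lra.
Qed.

Lemma norm2N s v : norm2 s (fun i => - v i) = norm2 s v.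
Proof. by rewrite /norm2 sqnormN. Qed.

Lemma norm2B s u w : norm2 s (fun i => u i - w i) <= norm2 s u + norm2 s w.
Proof. by rewrite -(norm2N s w); exact: norm2D. Qed.

Lemma norm2Z s (c : R) v : norm2 s (fun i => c * v i) = `|c| * norm2 s v.
Proof.
rewrite /norm2 (_ : sqnorm _ _ = c ^+ 2 * sqnorm s v).
  by rewrite sqrtrM ?sqr_ge0// sqrtr_sqr.
by rewrite /sqnorm mulr_sumr; apply: eq_bigr => i _; rewrite exprMn.
Qed.

Lemma norm2_midpoint s u w :
  2 * norm2 s u <= norm2 s (fun i => u i + w i) + norm2 s (fun i => u i - w i).
Proof.
apply: le_trans (norm2D s (fun i => u i + w i) (fun i => u i - w i)).
rewrite -[2]ger0_norm// -norm2Z le_eqVlt; apply/orP; left; apply/eqP.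
by congr norm2; apply/funext => i; ring.
Qed.

Lemma norm2_le_sum s v : norm2 s v <= \sum_(i <- s) `|v i|.
Proof.
elim: s => [|i s ih]; first by rewrite big_nil /norm2 sqnorm_nil sqrtr0.
rewrite big_cons norm2_le_sqr ?addr_ge0 ?sumr_ge0// sqnorm_cons sqrrD.
rewrite real_normK ?num_real// lerD//; last first.
  by rewrite -sqr_norm2 ler_sqr ?nnegrE ?sumr_ge0//.
by rewrite lerDl mulrn_wge0// mulr_ge0// sumr_ge0.
Qed.

Lemma sum_normrM_le_sqnorm s u v w :
  \sum_(i <- s) `|(u i - v i) * w i| <=
  sqnorm s u + sqnorm s v + sqnorm s w.
Proof.
rewrite /sqnorm -!big_split /=; apply: ler_sum => i _.
move: (u i) (v i) (w i) => a b c.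
have := sqr_ge0 a; have := sqr_ge0 b.
have := sqr_ge0 (a - c); have := sqr_ge0 (a + c).
have := sqr_ge0 (b - c); have := sqr_ge0 (b + c).
by rewrite ler_norml => *; apply/andP; split; lra.
Qed.

End finite_euclidean_norm.
#[local] Hint Extern 0 (is_true (0 <= sqnorm _ _)) => exact: sqnorm_ge0 : core.
#[local] Hint Extern 0 (is_true (0 <= norm2 _ _)) => exact: norm2_ge0 : core.

Lemma sqr_le_sqnorm (R : rcfType) (I : eqType) (s : seq I) (v : I -> R) i :
  i \in s -> v i ^+ 2 <= sqnorm s v.
Proof.
move=> si; rewrite /sqnorm (big_rem i si)/= lerDl sumr_ge0// => j _.
exact: sqr_ge0.
Qed.

Lemma sqnorm_iotaS (R : rcfType) (v : nat -> R) n :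
  sqnorm (seg n) v <= sqnorm (seg n.+1) v.
Proof. by rewrite /sqnorm [leRHS]big_nat_recr//= lerDl sqr_ge0. Qed.

Lemma le_sqnorm (R : rcfType) (I : eqType) (s : seq I) (u v : I -> R) :
  {in s, forall i, `|u i| <= `|v i|} -> sqnorm s u <= sqnorm s v.
Proof.
move=> uv; rewrite /sqnorm !big_seq; apply: ler_sum => i /uv.
rewrite -[u i ^+ 2]real_normK ?num_real// -[v i ^+ 2]real_normK ?num_real//.
by rewrite ler_sqr ?nnegrE.
Qed.

Lemma norm2_powR (R : realType) (I : Type) (s : seq I) (v : I -> R) (p : R) :
  norm2 s v `^ p = sqnorm s v `^ (p / 2).
Proof. by rewrite /norm2 -powR12_sqrt// -powRrM mulrC. Qed.

Section duality_map.
Variables (R : realType) (I : Type) (p : R) (s : seq I).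
Hypothesis p1 : 1 < p.
Implicit Types v : I -> R.

(* The gradient of [|v|^p / p]: it attains Hoelder's inequality against [v]. *)
Definition duality_map v : I -> R := fun i => norm2 s v `^ (p - 2) * v i.

Lemma norm2_duality_map v : norm2 s (duality_map v) = norm2 s v `^ (p - 1).
Proof.
rewrite norm2Z ger0_norm ?powR_ge0// mulrC -[RHS]mulr_powRB1 ?subr_gt0//.
by rewrite (_ : p - 1 - 1 = p - 2)//; ring.
Qed.

Lemma dot_duality_map v :
  \sum_(i <- s) v i * duality_map v i = norm2 s v `^ p.
Proof.
rewrite -mulr_powRB1 ?(lt_trans ltr01)// -norm2_duality_map.
rewrite norm2Z ger0_norm ?powR_ge0// mulrCA -expr2 sqr_norm2 /sqnorm mulr_sumr.
by apply: eq_bigr => i _; rewrite /duality_map mulrCA -expr2.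
Qed.

End duality_map.

Section bellman_functions.
Variables (R : realType) (I : Type) (s : seq I).
Implicit Types (U : (I -> R) -> R -> R) (v w : I -> R) (y l q : R).

Definition zigzag_concave U := forall v w y, 0 <= y ->
  (U (fun i => v i + w i)%R (y + sqnorm s w) +
   U (fun i => v i - w i) (y + sqnorm s w)) / 2 <= U v y.

(* Burkholder's special function for the weak type (1,1) inequality. *)
Definition weak_bellman l v y : R :=
  if (norm2 s v < l) && (y < (l - norm2 s v) ^+ 2) then y - sqnorm s v
  else l ^+ 2 - 2 * l * norm2 s v.

Lemma weak_bellman_le l v y :
  weak_bellman l v y <= l ^+ 2 - 2 * l * norm2 s v.
Proof.
rewrite /weak_bellman; case: ifPn => // /andP[_]; rewrite -sqr_norm2 sqrrB.
lra.
Qed.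

Lemma weak_bellman_concave l : 0 < l -> zigzag_concave (weak_bellman l).
Proof.
move=> l0 v w y y0; rewrite {3}/weak_bellman.
case: ifPn => [/andP[vl yv]|_]; last first.
  have := weak_bellman_le l (fun i => v i + w i) (y + sqnorm s w).
  have := weak_bellman_le l (fun i => v i - w i) (y + sqnorm s w).
  have := norm2_midpoint s v w; nra.
have le_small u : norm2 s u <= norm2 s v + norm2 s w ->
    weak_bellman l u (y + sqnorm s w) <= y + sqnorm s w - sqnorm s u.
  move=> uvw; rewrite /weak_bellman; case: ifPn => //.
  rewrite negb_and -!leNgt -!sqr_norm2 => large.
  suff : (l - norm2 s u) ^+ 2 <= y + norm2 s w ^+ 2 by rewrite sqrrB; lra.
  by case/orP : large => // lu; have := norm2_ge0 s w; nra.
have := le_small _ (norm2D s v w); have := le_small _ (norm2B s v w).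
by have := parallelogram s v w; lra.
Qed.

Lemma weak_bellman_diag_le0 l v : 0 < l -> weak_bellman l v (sqnorm s v) <= 0.
Proof.
move=> l0; rewrite /weak_bellman subrr; case: ifPn => //.
by rewrite negb_and -!leNgt -sqr_norm2; have := norm2_ge0 s v => v0 /orP[]; nra.
Qed.

Lemma weak_bellman_ge l v y : 0 < l -> 0 <= y ->
  l ^+ 2 * (l ^+ 2 <= y)%R%:R - 2 * l * norm2 s v <= weak_bellman l v y.
Proof.
move=> l0 y0; rewrite /weak_bellman; have := norm2_ge0 s v.
have := sqr_norm2 s v.
case: (boolP (_ && _)) => [/andP[vl yv] vv v0|_ _ v0]; last first.
  by rewrite lerD2r ler_piMr ?sqr_ge0// lern1 leq_b1.
rewrite (_ : (l ^+ 2 <= y) = false) ?mulr0; first by nra.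
by apply/negbTE; rewrite -ltNge; nra.
Qed.

Definition power_bellman q v y : R := y `^ q - q * y `^ (q - 1) * sqnorm s v.

Lemma power_bellman_concave q : 1 <= q -> zigzag_concave (power_bellman q).
Proof.
move=> q1 v w y y0; rewrite /power_bellman.
have v0 := sqnorm_ge0 s v; have w0 := sqnorm_ge0 s w.
have := parallelogram s v w.
move: (sqnorm s (fun i => v i + w i)) (sqnorm s (fun i => v i - w i)).
move=> a b ab; have -> : a = 2 * (sqnorm s v + sqnorm s w) - b by lra.
have yw : 0 <= y + sqnorm s w by rewrite addr_ge0.
have tangent := powR_ge_tangent q1 y0 yw.
have : q * sqnorm s v * y `^ (q - 1) <=
    q * sqnorm s v * (y + sqnorm s w) `^ (q - 1).
  rewrite ler_wpM2l ?mulr_ge0//; first by rewrite (le_trans ler01).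
  by apply: ge0_ler_powR; rewrite ?nnegrE ?subr_ge0 ?lerDl.
by move: tangent; lra.
Qed.

Lemma power_bellman_diag_le0 q v : 1 <= q ->
  power_bellman q v (sqnorm s v) <= 0.
Proof.
move=> q1; rewrite /power_bellman -mulrA [_ * sqnorm s v]mulrC.
rewrite mulr_powRB1//; last by lra.
by have := powR_ge0 (sqnorm s v) q; nra.
Qed.

(* For [y >= 2 q |v|^2] the subtracted term is at most [y^q / 2]; otherwise
   [y^(q-1)] is at most [(2 q |v|^2)^(q-1)]. *)
Lemma power_bellman_ge q v y : 1 <= q -> 0 <= y ->
  2^-1 * y `^ q - q * (2 * q) `^ (q - 1) * sqnorm s v `^ q <=
  power_bellman q v y.
Proof.
move=> q1 y0; rewrite /power_bellman; have v0 := sqnorm_ge0 s v.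
have q0 : 0 < q by lra.
have [vy|yv] := leP (2 * q * sqnorm s v) y.
  have := mulr_powRB1 y0 q0; have := powR_ge0 y (q - 1).
  have : 0 <= q * (2 * q) `^ (q - 1) * sqnorm s v `^ q.
    by rewrite !mulr_ge0 ?powR_ge0// ltW.
  nra.
have : y `^ (q - 1) <= (2 * q) `^ (q - 1) * sqnorm s v `^ (q - 1).
  rewrite -powRM//; last by lra.
  by apply: ge0_ler_powR; rewrite ?nnegrE ?subr_ge0 ?mulr_ge0//; lra.
move=> /(ler_wpM2l (mulr_ge0 (ltW q0) v0)).
rewrite -[sqnorm s v `^ q](mulr_powRB1 v0 q0); have := powR_ge0 y q; lra.
Qed.

End bellman_functions.

Section sequence_norm.
Variable R : realType.
Implicit Types (u v : nat -> R).

Lemma sqr_EFin_ge0 v k : (0 <= (v k ^+ 2)%:E)%E.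
Proof. by rewrite lee_fin sqr_ge0. Qed.

Lemma l2sq_ge0 v : (0 <= l2sq v)%E.
Proof. by apply: nneseries_ge0 => k _ _; exact: sqr_EFin_ge0. Qed.

Lemma sqnorm_sumE n v :
  (sqnorm (seg n) v)%:E = (\sum_(0 <= k < n) (v k ^+ 2)%:E)%E.
Proof. by rewrite /sqnorm -sumEFin. Qed.

Lemma sqnorm_le_l2sq n v : ((sqnorm (seg n) v)%:E <= l2sq v)%E.
Proof.
by rewrite sqnorm_sumE; apply: nneseries_lim_ge => k _ _; exact: sqr_EFin_ge0.
Qed.

Lemma l2sq_le v (c : \bar R) :
  (forall n, (sqnorm (seg n) v)%:E <= c)%E -> (l2sq v <= c)%E.
Proof.
move=> vc; apply: lime_le; last by apply: nearW => n; rewrite -sqnorm_sumE.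
by apply: is_cvg_nneseries => k _ _; exact: sqr_EFin_ge0.
Qed.

Lemma le_l2sq u v : (forall k, u k ^+ 2 <= v k ^+ 2) -> (l2sq u <= l2sq v)%E.
Proof.
by move=> uv; apply: lee_nneseries => k _ *; rewrite lee_fin ?uv ?sqr_ge0.
Qed.

Lemma sqr_le_l2sq v k : ((v k ^+ 2)%:E <= l2sq v)%E.
Proof.
apply: le_trans (sqnorm_le_l2sq k.+1 v); rewrite lee_fin.
by apply: sqr_le_sqnorm; rewrite mem_index_iota/=.
Qed.

Lemma normVE v : normV v = (l2sq v `^ 2^-1)%E.
Proof.
rewrite /normV; have := l2sq_ge0 v; case: (l2sq v) => [r| |]//.
  by rewrite lee_fin => r0; rewrite poweR_EFin powR12_sqrt.
by move=> _; rewrite poweRyr// gt_eqF.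
Qed.

Lemma normV_ge0 v : (0 <= normV v)%E.
Proof. by rewrite normVE poweR_ge0. Qed.

Lemma normV_poweR v (p : R) : (normV v `^ p)%E = (l2sq v `^ (p / 2))%E.
Proof. by rewrite normVE -poweRrM mulrC. Qed.

Lemma le_normV u v : (l2sq u <= l2sq v)%E -> (normV u <= normV v)%E.
Proof. by move=> uv; rewrite !normVE lee_poweR2r// l2sq_ge0. Qed.

Lemma norm2_le_normV n v : ((norm2 (seg n) v)%:E <= normV v)%E.
Proof.
rewrite normVE /norm2 -powR12_sqrt// -poweR_EFin lee_poweR2r ?lee_fin//.
exact: sqnorm_le_l2sq.
Qed.

Lemma normr_le_normV v k : (`|v k|%:E <= normV v)%E.
Proof.
rewrite normVE -sqrtr_sqr -powR12_sqrt ?sqr_ge0// -poweR_EFin.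
by rewrite lee_poweR2r ?sqr_EFin_ge0// sqr_le_l2sq.
Qed.

Lemma lt_normV (l : R) v : 0 <= l ->
  (l%:E < normV v)%E = ((l ^+ 2)%:E < l2sq v)%E.
Proof.
move=> l0; rewrite /normV; have := l2sq_ge0 v; case: (l2sq v) => [r| |]//.
  rewrite lee_fin !lte_fin => r0.
  by rewrite -[in RHS](sqr_sqrtr r0) ltr_sqr ?nnegrE ?sqrtr_ge0.
by rewrite !ltry.
Qed.

Lemma normV_poweR_le v (p : R) (c : \bar R) : 0 < p ->
  (forall n, (norm2 (seg n) v `^ p)%:E <= c)%E -> (normV v `^ p <= c)%E.
Proof.
move=> p0 vc; have p2 : 0 < p / 2 by rewrite divr_gt0.
have c0 : (0 <= c)%E by apply: le_trans (vc 0%N); rewrite lee_fin powR_ge0.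
rewrite -[leRHS]poweRe1// -(mulVf (lt0r_neq0 p2)) poweRrM normV_poweR.
apply: lee_poweR2r; rewrite ?l2sq_ge0 ?(ltW p2)//; apply: l2sq_le => n.
apply: lee_poweR_root; rewrite ?lee_fin// poweR_EFin -norm2_powR.
exact: vc.
Qed.

Lemma normV_le v (c : \bar R) :
  (forall n, (norm2 (seg n) v)%:E <= c)%E -> (normV v <= c)%E.
Proof.
move=> vc; rewrite -[normV v]poweRe1 ?normV_ge0//.
by apply: normV_poweR_le => // n; rewrite powRr1.
Qed.

Lemma is_l2P v : is_l2 v <-> (normV v < +oo)%E.
Proof.
rewrite normVE; split => [|v2]; first exact: poweR_lty.
by apply: lty_poweRy v2; rewrite invr_eq0.
Qed.

Lemma norm2_powR_le_normV n v (p : R) : 0 <= p ->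
  ((norm2 (seg n) v `^ p)%:E <= normV v `^ p)%E.
Proof.
move=> p0; rewrite -poweR_EFin lee_poweR2r ?norm2_le_normV//.
by rewrite lee_fin.
Qed.

Definition tail M v : nat -> R := fun k => if (M <= k)%N then v k else 0.

Lemma l2sq_tail M v : l2sq (tail M v) = (\sum_(M <= k <oo) (v k ^+ 2)%:E)%E.
Proof.
rewrite /l2sq (nneseries_split 0 M) => [|k _]; last exact: sqr_EFin_ge0.
rewrite add0n big_nat big1 ?add0e => [|k /andP[_ kM]]; last first.
  by rewrite /tail leqNgt kM expr0n.
by rewrite eseries_cond [RHS]eseries_cond; apply: eq_eseriesr => k /= Mk;
  rewrite /tail Mk.
Qed.

Lemma l2sq_split M v :
  l2sq v = ((sqnorm (seg M) v)%:E + l2sq (tail M v))%E.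
Proof.
rewrite l2sq_tail sqnorm_sumE /l2sq (nneseries_split 0 M) ?add0n// => k _.
exact: sqr_EFin_ge0.
Qed.

Lemma l2sq_tail_le M v : (l2sq (tail M v) <= l2sq v)%E.
Proof. by rewrite [leRHS](l2sq_split M) leeDr// lee_fin. Qed.

Lemma l2sq_tail_cvg0 v : is_l2 v -> (fun M => l2sq (tail M v)) @ \oo --> 0%E.
Proof.
move=> v2; under eq_fun do rewrite l2sq_tail.
by apply: nneseries_tail_cvg => // k _; exact: sqr_EFin_ge0.
Qed.

Lemma normV_tail_cvg0 v : is_l2 v -> (fun M => normV (tail M v)) @ \oo --> 0%E.
Proof.
move=> /l2sq_tail_cvg0/ge0_cvge0P => /(_ (fun M => l2sq_ge0 _)) small.
apply/ge0_cvge0P => [M|e e0]; first exact: normV_ge0.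
have := small _ (exprn_gt0 2 e0); apply: filterS => M.
by rewrite !leNgt lt_normV// ltW.
Qed.

Lemma norm2_le_normV_tail M N v :
  ((norm2 (index_iota M N) v)%:E <= normV (tail M v))%E.
Proof.
apply: le_trans (norm2_le_normV N _); rewrite lee_fin norm2_le_sqr// sqr_norm2.
have [NM|/ltnW MN] := leqP N M.
  by rewrite (_ : index_iota M N = [::]) ?sqnorm_nil// /index_iota (eqP NM).
rewrite /sqnorm [leRHS](@big_cat_nat _ _ _ M)//= ler_wpDl//.
  by apply: sumr_ge0 => k _; exact: sqr_ge0.
by rewrite !big_nat; apply: ler_sum => k /andP[Mk _]; rewrite /tail Mk.
Qed.

End sequence_norm.

Lemma lt_normV_bigcup (R : realType) (T : Type) (f : T -> nat -> R) (l : R) :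
  [set x | (l%:E < normV (f x))%E] =
  \bigcup_n [set x | l < norm2 (seg n) (f x)].
Proof.
apply/seteqP; split => x /=.
  apply: contraPP => not_big; apply/negP; rewrite -leNgt.
  apply: normV_le => n; rewrite lee_fin leNgt; apply/negP => fx.
  by apply: not_big; exists n.
by move=> [n _ /= fx]; apply: lt_le_trans (norm2_le_normV n _); rewrite lte_fin.
Qed.

Section sequence_norm_measurability.
Context d (T : measurableType d) (R : realType) (f : T -> nat -> R).
Hypothesis mf : forall k, measurable_fun setT (f^~ k).

Lemma measurable_norm2 s : measurable_fun setT (fun x => norm2 s (f x)).
Proof.
have -> : (fun x => norm2 s (f x)) = (fun x => sqnorm s (f x) `^ 2^-1).
  by apply/funext => x; rewrite powR12_sqrt.
apply: (measurableT_comp (measurable_powR 2^-1)).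
by apply: measurable_sum => k; exact: measurable_funX.
Qed.

Lemma measurable_l2sq : measurable_fun setT (fun x => l2sq (f x)).
Proof.
apply: ge0_emeasurable_sum => [k x _ _|k _]; first exact: sqr_EFin_ge0.
by apply/measurable_EFinP; exact: measurable_funX.
Qed.

Lemma measurable_normV : measurable_fun setT (fun x => normV (f x)).
Proof.
under eq_fun do rewrite normVE.
exact: (measurableT_comp (measurable_poweR 2^-1) measurable_l2sq).
Qed.

Lemma measurable_normV_poweR (p : R) :
  measurable_fun setT (fun x => normV (f x) `^ p)%E.
Proof. exact: (measurableT_comp (measurable_poweR p) measurable_normV). Qed.

Lemma integral_normV_poweR_le (mu : {measure set T -> \bar R}) (p : R)
    (c : \bar R) : 0 < p ->
  (forall n, \int[mu]_x (norm2 (seg n) (f x) `^ p)%:E <= c)%E ->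
  (\int[mu]_x (normV (f x) `^ p) <= c)%E.
Proof.
move=> p0 le_c; pose u n x : \bar R := (norm2 (seg n) (f x) `^ p)%:E.
have u0 n x : (0 <= u n x)%E by rewrite lee_fin powR_ge0.
have meas_u n : measurable_fun setT (u n).
  apply/measurable_EFinP.
  exact: (measurableT_comp (measurable_powR p) (measurable_norm2 _)).
have u_nd x : {homo u^~ x : m n / (m <= n)%N >-> (m <= n)%E}.
  apply/nondecreasing_seqP => n; rewrite lee_fin.
  apply: ge0_ler_powR; rewrite ?nnegrE ?(ltW p0)//.
  by rewrite ler_wsqrtr// sqnorm_iotaS.
apply: le_trans (ge0_integral_limn_le meas_u u0 u_nd le_c).
apply: ge0_le_integral => //.
- by move=> x _; exact: poweR_ge0.
- exact: measurable_normV_poweR.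
- exact: measurable_fun_limn.
move=> x _; apply: normV_poweR_le => // n.
apply: lime_ge; first exact: ereal_nondecreasing_is_cvgn (u_nd x).
by exists n => // m nm; exact: u_nd.
Qed.

End sequence_norm_measurability.

(** * The Cantor group and its kernel *)

Lemma addGK (a : G) : involutive (addG a).
Proof.
by move=> x; apply/funext => k; rewrite /addG; case: (a k); case: (x k).
Qed.

Lemma add0G (a : G) : addG emptyG a = a.
Proof. by apply/funext => k; rewrite /addG /emptyG; case: (a k). Qed.

Definition unitG (n : nat) : G := fun k => k == n.

Definition flip (n : nat) (x : G) : G := addG (unitG n) x.

Lemma flip_at n x : flip n x n = ~~ x n.
Proof. by rewrite /flip /addG /unitG eqxx; case: (x n). Qed.

Lemma flip_neq n i x : i != n -> flip n x i = x i.
Proof. by rewrite /flip /addG /unitG => /negbTE ->; case: (x i). Qed.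

Definition cylinder (n : nat) (x : G) : set G :=
  [set y | forall i, (i < n)%N -> y i = x i].

Lemma cylinderS n x : cylinder n.+1 x = cylinder n x `&` [set y | y n = x n].
Proof.
apply/seteqP; split => [y xy|y [xy /= xyn] i].
  by split => [i /ltnW|]; apply: xy.
by rewrite ltnS leq_eqVlt => /orP[/eqP ->//|]; exact: xy.
Qed.

Lemma cylinder0 x : cylinder 0 x = setT.
Proof. by apply/seteqP; split. Qed.

Lemma cylinder_eq n x y : cylinder n x y -> cylinder n y = cylinder n x.
Proof.
by move=> xy; apply/seteqP; split => z yz i ltin; rewrite yz// xy.
Qed.

Lemma subset_cylinder m n x : (m <= n)%N -> cylinder n x `<=` cylinder m x.
Proof. by move=> mn y xy i im; apply: xy; exact: leq_trans mn. Qed.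

Lemma cylinder_flip n m x : (n <= m)%N -> cylinder n x (flip m x).
Proof.
by move=> nm i ltin; rewrite flip_neq// ltn_eqF// (leq_trans ltin).
Qed.

Lemma cylinder_split n x :
  cylinder n x = cylinder n.+1 x `|` cylinder n.+1 (flip n x).
Proof.
apply/seteqP; split => [y xy|y [|]].
- rewrite !cylinderS (cylinder_eq (cylinder_flip x (leqnn n))) -setIUr.
  by split => //=; rewrite flip_at; case: (y n); case: (x n); auto.
- exact: subset_cylinder.
- move/(subset_cylinder (leqnSn n)).
  by rewrite (cylinder_eq (cylinder_flip x (leqnn n))).
Qed.

Lemma disjoint_cylinder_flip n x :
  [disjoint cylinder n.+1 x & cylinder n.+1 (flip n x)].
Proof.
apply/disj_setPS => y [] /(_ n (ltnSn n)) xy /(_ n (ltnSn n)).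
by rewrite flip_at xy; case: (x n).
Qed.

Lemma cylinder_addG n x y : cylinder n x (addG x y) <-> cylinder n emptyG y.
Proof.
by split=> xy i lt_in; move: (xy i lt_in); rewrite /addG /emptyG;
  case: (x i) (y i) => [] [].
Qed.

Lemma measurable_coordinate n b : measurable [set x : G | x n = b].
Proof. by apply: sub_sigma_algebra; exists n, b. Qed.

Lemma measurable_cylinder n x : measurable (cylinder n x).
Proof.
elim: n => [|n ih]; first by rewrite cylinder0.
by rewrite cylinderS; apply: measurableI => //; exact: measurable_coordinate.
Qed.
#[local] Hint Resolve measurable_cylinder : core.

Lemma measurable_addG a : measurable_fun [set: G] (addG a).
Proof.
apply: (@measurability _ _ G G setT (addG a) cylinders) => //.
move=> _ [_ [i [b ->] <-]].
rewrite setTI (_ : _ @^-1` _ = [set x : G | x i = xorb (a i) b]).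
  exact: measurable_coordinate.
apply/seteqP; rewrite /addG; split => x /=.
  by move=> <-; case: (a i); case: (x i).
by move=> ->; case: (a i); case: b.
Qed.

HB.instance Definition _ a :=
  isMeasurableFun.Build _ _ G G (addG a) (measurable_addG a).

Definition adapted {T : Type} (n : nat) (phi : G -> T) :=
  forall x y, cylinder n x y -> phi y = phi x.

Section adapted_theory.
Context {T U V : Type}.
Implicit Types (phi : G -> T) (psi : G -> U).

Lemma adapted_cst n (c : T) : adapted n (cst c).
Proof. by []. Qed.

Lemma adapted_flip n m phi x :
  adapted n phi -> (n <= m)%N -> phi (flip m x) = phi x.
Proof. by move=> aphi nm; apply: aphi; exact: cylinder_flip. Qed.

Lemma adaptedW m n phi : (m <= n)%N -> adapted m phi -> adapted n phi.
Proof. by move=> mn aphi x y /(subset_cylinder mn); exact: aphi. Qed.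

Lemma adapted_comp n (F : T -> U) phi : adapted n phi -> adapted n (F \o phi).
Proof. by move=> aphi x y /aphi /= ->. Qed.

Lemma adapted_comp2 n (F : T -> U -> V) phi psi :
  adapted n phi -> adapted n psi -> adapted n (fun x => F (phi x) (psi x)).
Proof. by move=> aphi apsi x y xy; rewrite (aphi _ _ xy) (apsi _ _ xy). Qed.

Lemma adapted_ind (P : (G -> T) -> Prop) : (forall c, P (cst c)) ->
  (forall n phi1 phi2, P phi1 -> P phi2 ->
    P (fun x => if x n then phi1 x else phi2 x)) ->
  forall n phi, adapted n phi -> P phi.
Proof.
move=> Pcst Pif; pose set_coord n b (x : G) : G :=
  fun k => if k == n then b else x k.
elim=> [|n ih] phi aphi.
  rewrite (_ : phi = cst (phi emptyG)) //; apply/funext => x.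
  by apply: aphi; rewrite cylinder0.
have aset b : adapted n (phi \o set_coord n b).
  move=> x y xy; apply: aphi => i; rewrite ltnS leq_eqVlt /set_coord.
  by case: eqVneq => //= _; exact: xy.
rewrite (_ : phi = fun x => if x n then phi (set_coord n true x)
                            else phi (set_coord n false x)).
  exact: Pif (ih _ (aset true)) (ih _ (aset false)).
apply/funext => x; have -> : phi x = phi (set_coord n (x n) x).
  by congr phi; apply/funext => k; rewrite /set_coord; case: eqVneq => [->|].
by case: (x n).
Qed.

End adapted_theory.

Lemma adapted_indic_cylinder (R : realType) n x :
  adapted n (\1_(cylinder n x) : G -> R).
Proof.
move=> y z yz; rewrite !indicE; congr (_%:R).
by congr nat_of_bool; apply/idP/idP; rewrite !inE => xy i ltin;
  rewrite -?xy// yz.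
Qed.

Lemma adapted_measurable d (T : measurableType d) n (phi : G -> T) :
  adapted n phi -> measurable_fun setT phi.
Proof.
move: n phi; apply: adapted_ind => // n phi psi mphi mpsi.
apply: measurable_fun_ifT => //.
apply: (measurable_fun_bool true); rewrite setTI.
exact: measurable_coordinate.
Qed.

Lemma adapted_measurable_set n (P : G -> bool) :
  adapted n P -> measurable [set x | P x].
Proof.
move=> aP; have := adapted_measurable aP measurableT (Y := [set true]).
by rewrite setTI; apply.
Qed.

Lemma adapted_bounded (R : realType) n (phi : G -> R) : adapted n phi ->
  exists M, forall x, `|phi x| <= M.
Proof.
move: n phi; apply: adapted_ind => [c|n phi psi [M phiM] [N psiN]].
  by exists `|c| => x.
exists (Num.max M N) => x.
by case: ifP => _; rewrite le_max ?phiM// psiN orbT.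
Qed.

Section kernel.
Variable R : realType.

Lemma cylinder_minG n y : cylinder n emptyG y <->
  ((if minG y is Some m then (n < m)%N else true) : bool).
Proof.
rewrite /minG; case: pselect => [y_neq0|y0]; last first.
  by split => // _ i _; apply/negP => yi; apply: y0; exists i.
case: ex_minnP => m ym minm; rewrite ltnS; split => [yn|nm i ltin].
  by rewrite leqNgt; apply/negP => mn; move: ym; rewrite yn.
apply/negP => yi; have := minm i yi.
by rewrite leqNgt (leq_trans ltin nm).
Qed.

Lemma indic_cylinder_emptyG n y : \1_(cylinder n emptyG) y =
  ((if minG y is Some m then (n < m)%N else true) : bool)%:R :> R.
Proof.
rewrite indicE; congr ((nat_of_bool _)%:R).
by apply/idP/idP => [/set_mem/cylinder_minG|/cylinder_minG/mem_set].
Qed.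

Lemma kappaE n y : kappa R n.+1 y =
  2 ^+ n.+1 * \1_(cylinder n.+1 emptyG) y - 2 ^+ n * \1_(cylinder n emptyG) y.
Proof.
rewrite !indic_cylinder_emptyG /kappa.
case: (minG y) => [m|]; last by rewrite !mulr1 exprS; lra.
have [_|_|->] := ltngtP n.+1 m.
- by rewrite !mulr1 exprS; lra.
- by rewrite !mulr0 subrr.
- by rewrite mulr0 mulr1 sub0r.
Qed.

Lemma kappa_cylinder n N y : (n <= N)%N -> cylinder N emptyG y ->
  kappa R n y = 2 ^+ n.-1.
Proof.
case: n => [//|n] nN /(subset_cylinder nN)/cylinder_minG; rewrite /kappa.
by case: (minG y) => // m ->.
Qed.

Lemma kappa_eq0 n N y : (N < n)%N -> ~ cylinder N emptyG y -> kappa R n y = 0.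
Proof.
case: n => // n; rewrite ltnS => Nn yN; rewrite kappaE !indicE.
by rewrite !memNset ?mulr0 ?subrr// => /subset_cylinder sub;
  apply/yN/sub => //; exact: leqW.
Qed.

Lemma kappa_outside_cylinder n N y : kappa R n \_ (~` cylinder N emptyG) y =
  if (n <= N)%N then kappa R n y - 2 ^+ n.-1 * \1_(cylinder N emptyG) y else 0.
Proof.
rewrite patchE indicE; have [yN|yN] := pselect (cylinder N emptyG y).
  rewrite memNset; last by apply.
  rewrite mem_set// mulr1; case: leqP => // nN.
  by rewrite (kappa_cylinder nN)// subrr.
rewrite mem_set// memNset// mulr0 subr0; case: leqP => // Nn.
exact: kappa_eq0 yN.
Qed.

Lemma indic_cylinder_addG n x y :
  \1_(cylinder n x) (addG x y) = \1_(cylinder n emptyG) y :> R.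
Proof.
rewrite !indicE; congr ((nat_of_bool _)%:R).
by apply/idP/idP => /set_mem/(cylinder_addG n x y)/mem_set.
Qed.

Lemma ballG_exp2 N : ballG emptyG ((2 ^+ N)^-1 : R) = cylinder N emptyG.
Proof.
apply/seteqP; rewrite /ballG /dG; split => y /=; rewrite add0G.
  move=> yN; apply/cylinder_minG; move: yN; case: (minG y) => // m.
  by rewrite ltf_pV2 ?posrE ?exprn_gt0// ltr_eXn2l// ltr1n.
move=> /cylinder_minG; case: (minG y) => [m|_].
  by rewrite ltf_pV2 ?posrE ?exprn_gt0// ltr_eXn2l// ltr1n.
by rewrite invr_gt0 exprn_gt0.
Qed.

Lemma ballG_cylinder M (r : R) : 0 < r -> r < (2 ^+ M)^-1 ->
  exists2 N, (M <= N)%N & ballG emptyG r = cylinder N emptyG.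
Proof.
move=> r0 rM; have exN : exists N, ((2 ^+ N.+1)^-1 < r :> R).
  have /cvgrPdist_lt/(_ r r0)[n _ small] := @cvg_invr_exp2 R.
  exists n; have := small n.+1 (leqnSn n).
  by rewrite /= sub0r normrN ger0_norm.
have [N rN minN] := ex_minnP exN; exists N.
  have := lt_trans rN rM.
  by rewrite ltf_pV2 ?posrE ?exprn_gt0// ltr_eXn2l// ltr1n.
apply/seteqP; rewrite /ballG /dG; split => y /=; rewrite add0G.
  move=> yr; apply/cylinder_minG; move: yr; case ym : (minG y) => [m|//].
  have : (0 < m)%N by move: ym; rewrite /minG; case: pselect => // H [<-].
  by case: m {ym} => // m _ /minN.
move=> /cylinder_minG; case: (minG y) => [m|//] Nm; apply: le_lt_trans rN.
by rewrite lef_pV2 ?posrE ?exprn_gt0// ler_weXn2l// ler1n.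
Qed.

End kernel.

(** * Dyadic averages *)

Section haar_measure.
Variables (R : realType) (mu : {measure set G -> \bar R}).
Hypothesis mu_prob : mu setT = 1%E.
Hypothesis mu_haar : forall (a : G) (A : set G), measurable A ->
  mu [set addG a y | y in A] = mu A.
Implicit Types (h u b : G -> R) (f g : G -> nat -> R).

Local Notation L1 h := (mu.-integrable setT (EFin \o h)).

Lemma fin_num_mu (A : set G) : measurable A -> mu A \is a fin_num.
Proof.
move=> mA; rewrite ge0_fin_numE// (@le_lt_trans _ _ 1%E) ?ltry// -mu_prob.
exact: subset_le_measure.
Qed.

Lemma integrable_bounded h (M : R) : measurable_fun setT h ->
  (forall x, `|h x| <= M) -> L1 h.
Proof.
move=> mh hM; apply: measurable_bounded_integrable => //.
  by rewrite -ge0_fin_numE// fin_num_mu.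
exists M; split; first exact: num_real.
by move=> N MN x _ /=; rewrite (le_trans (hM x))// ltW.
Qed.

Lemma integrable_adapted n h : adapted n h -> L1 h.
Proof.
move=> ah; have [M hM] := adapted_bounded ah.
exact: integrable_bounded (adapted_measurable ah) hM.
Qed.

Lemma integrable_cst_prob (c : R) : L1 (cst c).
Proof. exact: (@integrable_adapted 0). Qed.

Lemma integrableM_adapted n h b : L1 h -> adapted n b ->
  L1 (fun x => h x * b x).
Proof.
move=> hi ab; have [M bM] := adapted_bounded ab.
exact: integrableM_bounded hi (adapted_measurable ab) bM.
Qed.

Lemma Rintegral_cst_prob (c : R) : \int[mu]_x c = c.
Proof. by rewrite Rintegral_cst// mu_prob mulr1. Qed.

Lemma mu_preimage_addG a A : measurable A -> mu (addG a @^-1` A) = mu A.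
Proof.
move=> mA; rewrite -(mu_haar a mA); congr (mu _); apply/seteqP; split.
  by move=> x /= ?; exists (addG a x) => //; rewrite addGK.
by move=> _ [y Ay <-] /=; rewrite addGK.
Qed.

Lemma integral_pushforward_addG a (h : G -> \bar R) :
  (\int[pushforward mu (addG a)]_x h x = \int[mu]_x h x)%E.
Proof. by apply: eq_measure_integral => A mA _; exact: mu_preimage_addG. Qed.

Lemma integrable_addG a h : L1 h -> L1 (h \o addG a).
Proof.
move=> /integrableP[mh h_oo]; apply/integrableP; split.
  exact: (measurableT_comp mh (measurable_addG a)).
rewrite (le_lt_trans _ h_oo)// -[leRHS](integral_pushforward_addG a).
rewrite (ge0_integral_pushforward (measurable_addG a))//.
exact: measurableT_comp.
Qed.

Lemma Rintegral_addG a h : L1 h ->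
  \int[mu]_x h (addG a x) = \int[mu]_x h x.
Proof.
move=> hi; congr fine; rewrite -[RHS](integral_pushforward_addG a).
rewrite (integral_pushforward (measurable_addG a))//.
- exact: measurable_int hi.
- exact: integrable_addG hi.
Qed.

Lemma mu_cylinder n x : mu (cylinder n x) = ((2 ^+ n)^-1)%:E.
Proof.
elim: n x => [|n ih] x; first by rewrite cylinder0 mu_prob expr0 invr1.
have mu_flip : mu (cylinder n.+1 (flip n x)) = mu (cylinder n.+1 x).
  rewrite -(mu_preimage_addG (unitG n))//; congr (mu _).
  apply/seteqP; split => y /= xy i lt_in; have := xy i lt_in;
    rewrite -?/(flip n y); case: (eqVneq i n) => [->|ni].
  - by rewrite !flip_at; case: (y n) (x n) => [] [].
  - by rewrite !flip_neq.
  - by rewrite !flip_at => ->.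
  - by rewrite !flip_neq.
have : (mu (cylinder n.+1 x) + mu (cylinder n.+1 x))%E = ((2 ^+ n)^-1)%:E.
  rewrite -(ih x) [in RHS]cylinder_split measureU//.
    by congr (_ + _)%E; rewrite -mu_flip.
  by apply/eqP; rewrite -disj_set2E; exact: disjoint_cylinder_flip.
rewrite -[mu (cylinder n.+1 x)]fineK ?fin_num_mu// -EFinD => -[two_mu].
by congr EFin; rewrite exprS invfM -two_mu; lra.
Qed.

Definition avg n h x : R := 2 ^+ n * \int[mu]_(y in cylinder n x) h y.

Lemma adapted_avg n h : adapted n (avg n h).
Proof. by move=> x y xy; rewrite /avg (cylinder_eq xy). Qed.

Lemma integrable_avg n h : L1 (avg n h).
Proof. exact: integrable_adapted (@adapted_avg n h). Qed.

Lemma integrable_cylinder n x h : L1 h ->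
  mu.-integrable (cylinder n x) (EFin \o h).
Proof. by apply: integrableS. Qed.

Lemma avg_midpoint n h x : L1 h ->
  avg n h x = (avg n.+1 h x + avg n.+1 h (flip n x)) / 2.
Proof.
move=> hi; rewrite /avg [in LHS]cylinder_split Rintegral_setU//.
- by rewrite -mulrDr exprS; field.
- by apply: integrableS hi => //; exact: measurableU.
- exact: disjoint_cylinder_flip.
Qed.

Lemma avg0 h x : avg 0 h x = \int[mu]_y h y.
Proof. by rewrite /avg cylinder0 expr0 mul1r. Qed.

Lemma avg_cst n (c : R) x : avg n (cst c) x = c.
Proof.
by rewrite /avg Rintegral_cst// mu_cylinder /= mulrC -mulrA mulVf ?mulr1.
Qed.

Lemma avg_ge0 n h x : (forall y, 0 <= h y) -> 0 <= avg n h x.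
Proof. by move=> h0; rewrite mulr_ge0 ?exprn_ge0// Rintegral_ge0. Qed.

Lemma avgD n h u x : L1 h -> L1 u ->
  avg n (fun y => h y + u y) x = avg n h x + avg n u x.
Proof.
by move=> hi ui; rewrite /avg RintegralD ?mulrDr//;
  exact: integrable_cylinder.
Qed.

Lemma avgB n h u x : L1 h -> L1 u ->
  avg n (fun y => h y - u y) x = avg n h x - avg n u x.
Proof.
by move=> hi ui; rewrite /avg RintegralB ?mulrBr//;
  exact: integrable_cylinder.
Qed.

Lemma avgM_adapted n h b x : L1 h -> adapted n b ->
  avg n (fun y => b y * h y) x = b x * avg n h x.
Proof.
move=> hi ab; rewrite /avg (eq_Rintegral _ (g := fun y => b x * h y)).
  by rewrite RintegralZl//; [rewrite mulrCA|exact: integrable_cylinder].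
by move=> y /set_mem xy; rewrite (ab _ _ xy).
Qed.

Lemma avgZ n (c : R) h x : L1 h -> avg n (fun y => c * h y) x = c * avg n h x.
Proof. by move=> hi; rewrite (avgM_adapted x hi (adapted_cst c)). Qed.

Lemma avg_sum n (I : Type) (s : seq I) (h : I -> G -> R) x :
  (forall i, L1 (h i)) ->
  avg n (fun y => \sum_(i <- s) h i y) x = \sum_(i <- s) avg n (h i) x.
Proof.
move=> hi; elim: s => [|i s ih].
  under [in LHS]eq_fun do rewrite big_nil.
  by rewrite big_nil avg_cst.
under [in LHS]eq_fun do rewrite big_cons.
by rewrite big_cons avgD// ?ih//; exact: integrable_sum_EFin.
Qed.

Lemma ae_eq_avg n h u x : measurable_fun setT h -> measurable_fun setT u ->
  {ae mu, forall y, h y = u y} -> avg n h x = avg n u x.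
Proof.
move=> mh meas_u hu; congr (_ * fine _); apply: ae_eq_integral => //.
- exact/measurable_EFinP/measurable_funTS.
- exact/measurable_EFinP/measurable_funTS.
- by move: hu; apply: filterS => y /= ->.
Qed.

Lemma ae_le_avg n h u x : L1 h -> L1 u ->
  {ae mu, forall y, h y <= u y} -> avg n h x <= avg n u x.
Proof.
move=> hi ui hu; rewrite -subr_ge0 -avgB//.
have meas_diff := integrable_measurable (integrableB_EFin ui hi).
rewrite (@ae_eq_avg n _ (fun y => `|u y - h y|))//.
- by apply: avg_ge0 => y; exact: normr_ge0.
- exact: measurableT_comp.
- by move: hu; apply: filterS => y; rewrite -subr_ge0 => /ger0_norm.
Qed.

Lemma le_avg n h u x : L1 h -> L1 u -> (forall y, h y <= u y) ->
  avg n h x <= avg n u x.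
Proof. by move=> hi ui hu; apply: ae_le_avg => //; exact: aeW. Qed.

(* The integral of an adapted function does not change when it is averaged over
   a coordinate flip, so the one-step inequality integrates. *)
Lemma supermartingale_Rintegral (F : nat -> G -> R) n x :
  (forall m, adapted m (F m)) ->
  (forall m y, (F m.+1 y + F m.+1 (flip m y)) / 2 <= F m y) ->
  \int[mu]_y F n y <= F 0%N x.
Proof.
move=> aF superF; elim: n => [|n ih].
  rewrite (_ : F 0%N = cst (F 0%N x)) ?Rintegral_cst_prob//.
  by apply/funext => y; apply: aF; rewrite cylinder0.
apply: le_trans ih; have Fi m := integrable_adapted (aF m).
have flipi : L1 (F n.+1 \o flip n) by exact: integrable_addG.
have -> : \int[mu]_y F n.+1 y =
    \int[mu]_y (2^-1 * (F n.+1 y + F n.+1 (flip n y))).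
  rewrite RintegralZl//; last exact: integrableD_EFin.
  by rewrite RintegralD// [in X in _ + X]Rintegral_addG//; field.
apply: le_Rintegral => // [|y _]; last by rewrite mulrC.
exact/integrableZl_EFin/integrableD_EFin.
Qed.

Lemma Rintegral_avg n h : L1 h -> \int[mu]_x avg n h x = \int[mu]_x h x.
Proof.
move=> hi; apply/eqP; rewrite eq_le -(avg0 h emptyG); apply/andP; split.
  apply: (@supermartingale_Rintegral (avg^~ h)) => m; first exact: adapted_avg.
  by move=> y; rewrite (avg_midpoint m y hi).
rewrite -lerN2.
have -> : - (\int[mu]_y avg n h y) = \int[mu]_y (-1 * avg n h y).
  by rewrite [RHS]RintegralZl//; [rewrite mulN1r|exact: integrable_avg].
rewrite -[leRHS]mulN1r.
apply: (@supermartingale_Rintegral (fun m y => -1 * avg m h y)) => m.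
  exact: adapted_comp (@adapted_avg m h).
by move=> y; rewrite (avg_midpoint m y hi); lra.
Qed.

Lemma avg_adapted m n h x : (m <= n)%N -> adapted m h -> avg n h x = h x.
Proof.
move=> mn ah; rewrite -[RHS]mulr1 -(avg_cst n 1 x).
rewrite -(avgM_adapted _ (integrable_cst_prob 1) (adaptedW mn ah)).
by congr (avg _ _ _); apply/funext => y; rewrite mulr1.
Qed.

Lemma avg_tower m n h x : (m <= n)%N -> L1 h ->
  avg m (avg n h) x = avg m h x.
Proof.
move=> mn hi; congr (_ * _).
rewrite -[LHS]Rintegral_indicM -[RHS]Rintegral_indicM.
have a1 := adaptedW mn (@adapted_indic_cylinder R m x).
rewrite -[RHS](Rintegral_avg n); last exact: integrable_indicM.
by apply: eq_Rintegral => y _; rewrite (avgM_adapted _ hi a1).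
Qed.

Lemma Rintegral_avg_selfadjoint n h b (M : R) : L1 h ->
  measurable_fun setT b -> (forall x, `|b x| <= M) ->
  \int[mu]_x (avg n h x * b x) = \int[mu]_x (h x * avg n b x).
Proof.
move=> hi mb bM; have bi := integrable_bounded mb bM.
have a_avg k := @adapted_avg n k.
rewrite -[LHS](Rintegral_avg n); last first.
  by apply: integrableM_bounded bM => //; exact: integrable_avg.
rewrite -[RHS](Rintegral_avg n); last exact: integrableM_adapted hi (a_avg b).
apply: eq_Rintegral => x _; rewrite (avgM_adapted _ bi (a_avg h)) mulrC.
rewrite -(avgM_adapted _ hi (a_avg b)).
by congr (avg _ _ _); apply/funext => y; rewrite mulrC.
Qed.

Lemma avg_jensen (p : R) n h x : 1 <= p -> (forall y, 0 <= h y) -> L1 h ->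
  L1 (fun y => h y `^ p) -> avg n h x `^ p <= avg n (fun y => h y `^ p) x.
Proof.
move=> p1 h0 hi hpi; set a := avg n h x.
have ci c := integrable_cst_prob c.
have tangi : L1 (fun y => p * a `^ (p - 1) * (h y - cst a y)).
  exact/integrableZl_EFin/integrableB_EFin.
have -> : a `^ p =
    avg n (fun y => cst (a `^ p) y + p * a `^ (p - 1) * (h y - cst a y)) x.
  rewrite avgD// avgZ ?avgB ?avg_cst ?subrr ?mulr0 ?addr0//.
  exact: integrableB_EFin.
apply: le_avg => // [|y]; first exact: integrableD_EFin.
exact: powR_ge_tangent (avg_ge0 _ _ h0).
Qed.

Lemma Rintegral_indic_prob A : measurable A -> \int[mu]_x \1_A x = fine (mu A).
Proof. by move=> mA; rewrite /Rintegral integral_indic// setIT. Qed.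

Lemma integrable_indic_prob A : measurable A -> L1 (\1_A : G -> R).
Proof.
move=> mA; apply: (@integrable_bounded _ 1); first exact: measurable_indic.
by move=> x; rewrite indicE; case: (_ \in _); rewrite ?normr1 ?normr0.
Qed.

(** * The square function *)

Definition vavg n f (x : G) : nat -> R := fun k => avg n (f^~ k) x.

Definition vincr n f (x : G) : nat -> R :=
  fun k => vavg n.+1 f x k - vavg n f x k.

Lemma adapted_vavg n f : adapted n (vavg n f).
Proof. by move=> x y xy; apply/funext => k; exact: adapted_avg xy. Qed.

Lemma vavgS n f x : vavg n.+1 f x = fun k => vavg n f x k + vincr n f x k.
Proof. by apply/funext => k; rewrite /vincr addrC subrK. Qed.

Lemma vavgS_flip n f x : (forall k, L1 (f^~ k)) ->
  vavg n.+1 f (flip n x) = fun k => vavg n f x k - vincr n f x k.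
Proof.
move=> fi; apply/funext => k; rewrite /vincr /vavg.
by have := avg_midpoint n x (fi k); lra.
Qed.

Definition quadvar s f n (x : G) : R :=
  sqnorm s (vavg 0 f x) + \sum_(j < n) sqnorm s (vincr j f x).

Lemma adapted_quadvar s f n : adapted n (quadvar s f n).
Proof.
move=> x y xy; rewrite /quadvar (adaptedW (leq0n n) (@adapted_vavg 0 f) xy).
congr (_ + _); apply: eq_bigr => j _; rewrite /vincr.
rewrite (adaptedW (ltn_ord j) (@adapted_vavg j.+1 f) xy).
by rewrite (adaptedW (ltnW (ltn_ord j)) (@adapted_vavg j f) xy).
Qed.

Lemma quadvar_ge0 s f n x : 0 <= quadvar s f n x.
Proof. by apply: addr_ge0 => //; apply: sumr_ge0. Qed.

Lemma quadvarS s f n x :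
  quadvar s f n.+1 x = quadvar s f n x + sqnorm s (vincr n f x).
Proof. by rewrite /quadvar big_ord_recr /= addrA. Qed.

Lemma adapted_vavg_quadvar s f n (U : (nat -> R) -> R -> R) :
  adapted n (fun x => U (vavg n f x) (quadvar s f n x)).
Proof. exact: adapted_comp2 (@adapted_vavg n f) (@adapted_quadvar s f n). Qed.

Lemma Rintegral_zigzag_concave_le s f (U : (nat -> R) -> R -> R) n x :
  (forall k, L1 (f^~ k)) -> zigzag_concave s U ->
  \int[mu]_y U (vavg n f y) (quadvar s f n y) <=
  U (vavg 0 f x) (sqnorm s (vavg 0 f x)).
Proof.
move=> fi concU; have -> : sqnorm s (vavg 0 f x) = quadvar s f 0 x.
  by rewrite /quadvar big_ord0 addr0.
apply: (@supermartingale_Rintegral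
    (fun m y => U (vavg m f y) (quadvar s f m y))) => m.
  exact: adapted_vavg_quadvar.
move=> y; rewrite !quadvarS (vavgS_flip _ _ fi) vavgS.
rewrite (adapted_flip y (@adapted_quadvar s f m) (leqnn m)).
have -> : sqnorm s (vincr m f (flip m y)) = sqnorm s (vincr m f y).
  rewrite -[RHS]sqnormN; congr sqnorm; apply/funext => k.
  rewrite {1}/vincr (vavgS_flip _ _ fi).
  rewrite (adapted_flip y (@adapted_vavg m f) (leqnn m)); ring.
exact: concU (quadvar_ge0 _ _ _ _).
Qed.

Lemma integrable_norm2 s f : (forall k, L1 (f^~ k)) ->
  L1 (fun x => norm2 s (f x)).
Proof.
move=> fi.
apply: (@le_integrable_EFin _ _ _ _ _ (fun x => \sum_(k <- s) `|f x k|)).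
- by apply: measurable_norm2 => k; exact: integrable_measurable (fi k).
- by move=> x; rewrite ger0_norm// norm2_le_sum.
- apply: (integrable_sum_EFin s (h := fun k x => `|f x k|)) => k.
  exact: integrable_norm (fi k).
Qed.

(* Minkowski's inequality, by pairing the average with itself. *)
Lemma norm2_vavg_le s f n x : (forall k, L1 (f^~ k)) ->
  norm2 s (vavg n f x) <= avg n (fun y => norm2 s (f y)) x.
Proof.
move=> fi; set v := vavg n f x.
have [v0|v_neq0] := eqVneq (norm2 s v) 0; first by rewrite v0 avg_ge0.
have v_gt0 : 0 < norm2 s v by rewrite lt_neqAle eq_sym v_neq0 norm2_ge0.
have vfi k : L1 (fun y => v k * f y k) by exact: integrableZl_EFin.
rewrite -(ler_pM2l v_gt0) -expr2 sqr_norm2 -avgZ; last exact: integrable_norm2.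
have -> : sqnorm s v = avg n (fun y => \sum_(k <- s) v k * f y k) x.
  rewrite (avg_sum _ _ _ (h := fun k y => v k * f y k))//.
  by apply: eq_bigr => k _; rewrite avgZ.
apply: le_avg => [||y]; last exact: cauchy_schwarz.
- exact: (integrable_sum_EFin s (h := fun k y => v k * f y k)).
- exact/integrableZl_EFin/integrable_norm2.
Qed.

Lemma Rintegral_norm2_vavg_powR_le (p : R) s f n : 1 <= p ->
  (forall k, L1 (f^~ k)) -> L1 (fun x => norm2 s (f x) `^ p) ->
  \int[mu]_x (norm2 s (vavg n f x) `^ p) <= \int[mu]_x (norm2 s (f x) `^ p).
Proof.
move=> p1 fi fpi; rewrite -(Rintegral_avg n fpi).
apply: (le_Rintegral measurableT).
- exact: integrable_adapted (adapted_comp (fun v => norm2 s v `^ p)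
    (@adapted_vavg n f)).
- exact: integrable_avg.
move=> x _; apply: le_trans (avg_jensen n x p1 _ _ fpi) => //; last first.
  exact: integrable_norm2.
apply: ge0_ler_powR; rewrite ?nnegrE ?avg_ge0 ?norm2_vavg_le//.
exact: le_trans p1.
Qed.

Lemma Rintegral_norm2_vavg_le s f n : (forall k, L1 (f^~ k)) ->
  \int[mu]_x norm2 s (vavg n f x) <= \int[mu]_x norm2 s (f x).
Proof.
move=> fi; have powR1_norm2 (F : G -> nat -> R) :
    (fun x => norm2 s (F x) `^ 1) = fun x => norm2 s (F x).
  by apply/funext => x; rewrite powRr1.
have := @Rintegral_norm2_vavg_powR_le 1 s f n (lexx 1) fi.
by rewrite !powR1_norm2; apply; exact: integrable_norm2.
Qed.

Lemma weak_type_quadvar s f n (l : R) : 0 < l -> (forall k, L1 (f^~ k)) ->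
  l * fine (mu [set x | l ^+ 2 <= quadvar s f n x]) <=
  2 * \int[mu]_x norm2 s (f x).
Proof.
move=> l0 fi; set A := [set x | _].
have mA : measurable A.
  exact: adapted_measurable_set
    (adapted_comp (fun y => l ^+ 2 <= y) (@adapted_quadvar s f n)).
have vi : L1 (fun x => norm2 s (vavg n f x)).
  exact: integrable_adapted (adapted_comp (norm2 s) (@adapted_vavg n f)).
have Ai := integrable_indic_prob mA.
have : \int[mu]_x (l ^+ 2 * \1_A x - 2 * l * norm2 s (vavg n f x)) <= 0.
  apply: le_trans (weak_bellman_diag_le0 s (vavg 0 f emptyG) l0).
  apply: le_trans (Rintegral_zigzag_concave_le n emptyG fi
    (weak_bellman_concave s l0)).
  apply: (le_Rintegral measurableT).
  - by apply: integrableB_EFin; exact: integrableZl_EFin.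
  - exact: integrable_adapted (@adapted_vavg_quadvar s f n _).
  - by move=> x _; rewrite indic_pred weak_bellman_ge// quadvar_ge0.
rewrite RintegralB ?RintegralZl ?Rintegral_indic_prob//; last 2 first.
- exact: integrableZl_EFin.
- exact: integrableZl_EFin.
have := Rintegral_norm2_vavg_le s n fi; rewrite -(ler_pM2l l0) => le_f le_v.
by rewrite -(ler_pM2l l0) mulrA -expr2; move: le_f le_v; lra.
Qed.

Lemma quadvar_Lp (p : R) : 2 <= p -> exists2 C, 0 < C & forall s f n,
  (forall k, L1 (f^~ k)) -> L1 (fun x => norm2 s (f x) `^ p) ->
  \int[mu]_x (quadvar s f n x `^ (p / 2)) <=
  C * \int[mu]_x (norm2 s (f x) `^ p).
Proof.
move=> p2; set q := p / 2; have q1 : 1 <= q by rewrite ler_pdivlMr// mul1r.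
pose C := q * (2 * q) `^ (q - 1).
have C0 : 0 < C by rewrite mulr_gt0 ?powR_gt0//; lra.
exists (2 * C) => [|s f n fi fpi]; first exact: mulr_gt0.
have vi : L1 (fun x => norm2 s (vavg n f x) `^ p).
  exact: integrable_adapted (adapted_comp (fun v => norm2 s v `^ p)
    (@adapted_vavg n f)).
have Si : L1 (fun x => quadvar s f n x `^ q).
  exact: integrable_adapted (adapted_comp (fun y => y `^ q)
    (@adapted_quadvar s f n)).
have : \int[mu]_x (2^-1 * quadvar s f n x `^ q -
    C * norm2 s (vavg n f x) `^ p) <= 0.
  apply: le_trans (power_bellman_diag_le0 s (vavg 0 f emptyG) q1).
  apply: le_trans (Rintegral_zigzag_concave_le n emptyG fi
    (power_bellman_concave s q1)).
  apply: (le_Rintegral measurableT).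
  - by apply: integrableB_EFin; exact: integrableZl_EFin.
  - exact: integrable_adapted (@adapted_vavg_quadvar s f n _).
  - by move=> x _; rewrite norm2_powR power_bellman_ge// quadvar_ge0.
rewrite RintegralB ?RintegralZl//; [|exact: integrableZl_EFin..].
have half_le (a b c : R) : 2^-1 * a - b <= 0 -> b <= c -> a <= 2 * c by lra.
move=> /half_le bound; rewrite -[leRHS]mulrA; apply: bound.
have p1 : 1 <= p by rewrite (le_trans _ p2)// ler1n.
exact: ler_wpM2l (ltW C0) _ _ (Rintegral_norm2_vavg_powR_le n p1 fi fpi).
Qed.

(** * Martingale differences *)

Definition Delta n h (x : G) : R :=
  if n is m.+1 then avg n h x - avg m h x else avg 0 h x.

Definition DeltaV f (x : G) : nat -> R := fun k => Delta k (f^~ k) x.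

Lemma adapted_Delta n h : adapted n (Delta n h).
Proof.
case: n => [|n]; first exact: adapted_avg.
apply: (@adapted_comp2 _ _ _ n.+1 (fun a b : R => a - b)).
  exact: adapted_avg.
exact: adaptedW (leqnSn n) (@adapted_avg n h).
Qed.

Lemma integrable_Delta n h : L1 (Delta n h).
Proof. exact: integrable_adapted (@adapted_Delta n h). Qed.

Lemma ae_eq_Delta n h u x : measurable_fun setT h -> measurable_fun setT u ->
  {ae mu, forall y, h y = u y} -> Delta n h x = Delta n u x.
Proof.
move=> mh meas_u hu.
by case: n => [|n] /=; rewrite !(ae_eq_avg _ _ mh meas_u hu).
Qed.

Lemma Delta_idem n h x : L1 h -> Delta n (Delta n h) x = Delta n h x.
Proof.
case: n => [|n] hi /=.
  exact: (avg_adapted _ (leqnn 0) (@adapted_avg 0 h)).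
rewrite (avg_adapted _ (leqnn n.+1) (@adapted_Delta n.+1 h)).
by rewrite avgB ?avg_tower ?subrr ?subr0//; exact: integrable_avg.
Qed.

Lemma Rintegral_Delta_selfadjoint n h b (M : R) : L1 h ->
  measurable_fun setT b -> (forall x, `|b x| <= M) ->
  \int[mu]_x (Delta n h x * b x) = \int[mu]_x (h x * Delta n b x).
Proof.
move=> hi mb bM; case: n => [|n] /=; first exact: Rintegral_avg_selfadjoint bM.
have avg_h_bi m : L1 (fun x => avg m h x * b x).
  exact: integrableM_bounded (integrable_avg m h) mb bM.
have h_avg_bi m : L1 (fun x => h x * avg m b x).
  exact: integrableM_adapted hi (@adapted_avg m b).
under eq_Rintegral do rewrite mulrBl.
under [RHS]eq_Rintegral do rewrite mulrBr.
by rewrite !RintegralB// !(Rintegral_avg_selfadjoint _ hi mb bM).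
Qed.

Lemma adapted_DeltaV n f k : (k <= n)%N -> adapted n (fun x => DeltaV f x k).
Proof. by move=> kn; apply: (adaptedW kn); exact: adapted_Delta. Qed.

Lemma adapted_norm2_DeltaV n f :
  adapted n (fun x => norm2 (seg n) (DeltaV f x)).
Proof.
move=> x y xy; congr Num.sqrt; apply: eq_big_seq => k; rewrite mem_index_iota.
by move=> /andP[_ /ltnW/(adapted_DeltaV f)/(_ _ _ xy) ->].
Qed.

Lemma integrable_norm2_DeltaV_powR n f (p : R) :
  L1 (fun x => norm2 (seg n) (DeltaV f x) `^ p).
Proof.
exact: integrable_adapted (adapted_comp (fun y => y `^ p)
  (@adapted_norm2_DeltaV n f)).
Qed.

Lemma sqnorm_DeltaV_le n f x :
  sqnorm (seg n) (DeltaV f x) <= quadvar (seg n) f n x.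
Proof.
case: n => [|n]; first by rewrite {1}/index_iota sqnorm_nil quadvar_ge0.
rewrite quadvarS ler_wpDr// {1}/sqnorm big_nat_recl// /quadvar lerD//.
  exact: (@sqr_le_sqnorm _ _ _ (vavg 0 f x)).
rewrite big_mkord; apply: ler_sum => j _.
by apply: (@sqr_le_sqnorm _ _ _ (vincr j f x)); rewrite mem_index_iota /= ltnS.
Qed.

Definition DeltaV_Lp_bounded (p C : R) := forall n f,
  (forall k, L1 (f^~ k)) -> L1 (fun x => norm2 (seg n) (f x) `^ p) ->
  \int[mu]_x (norm2 (seg n) (DeltaV f x) `^ p) <=
  C * \int[mu]_x (norm2 (seg n) (f x) `^ p).

Lemma DeltaV_Lp_bounded_ge2 (p : R) : 2 <= p ->
  exists2 C, 0 < C & DeltaV_Lp_bounded p C.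
Proof.
move=> p2; have [C C0 quadvarC] := quadvar_Lp p2; exists C => // n f fi fpi.
apply: le_trans (quadvarC (seg n) f n fi fpi).
apply: (le_Rintegral measurableT).
  exact: integrable_norm2_DeltaV_powR.
  exact: integrable_adapted (adapted_comp (fun y => y `^ (p / 2))
    (@adapted_quadvar (seg n) f n)).
move=> x _; rewrite norm2_powR.
apply: ge0_ler_powR; rewrite ?nnegrE ?quadvar_ge0 ?sqnorm_DeltaV_le//.
by rewrite divr_ge0// (le_trans _ p2).
Qed.

Lemma Rintegral_DeltaV_selfadjoint s f g : (forall k, L1 (f^~ k)) ->
  (forall k, exists m, adapted m (g^~ k)) ->
  \int[mu]_x (\sum_(k <- s) DeltaV f x k * g x k) =
  \int[mu]_x (\sum_(k <- s) f x k * DeltaV g x k).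
Proof.
move=> fi ag; rewrite (Rintegral_sum s (h := fun k x => DeltaV f x k * g x k)).
  rewrite (Rintegral_sum s (h := fun k x => f x k * DeltaV g x k)).
    apply: eq_bigr => k _; have [m akg] := ag k.
    have [M gM] := adapted_bounded akg.
    exact: Rintegral_Delta_selfadjoint (fi k) (adapted_measurable akg) gM.
  by move=> k; apply: integrableM_adapted (fi k) (@adapted_Delta k _).
move=> k; have [m akg] := ag k.
exact: integrableM_adapted (integrable_Delta _ _) akg.
Qed.

Lemma adapted_duality_map_DeltaV (p : R) n f k :
  adapted (maxn n k) (fun x => duality_map p (seg n) (DeltaV f x) k).
Proof.
apply: (@adapted_comp2 _ _ _ _ (fun a b : R => a `^ (p - 2) * b)).
  exact: adaptedW (leq_maxl n k) (@adapted_norm2_DeltaV n f).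
exact: (@adapted_DeltaV _ f k (leq_maxr n k)).
Qed.

(* Test [DeltaV f] against [g = |DeltaV f|^(p-2) DeltaV f], for which
   [|g|^q = |DeltaV f|^p], and absorb half of [|DeltaV f|_p^p]. *)
Lemma DeltaV_Lp_bounded_dual (p q C : R) : 1 < p -> p^-1 + q^-1 = 1 -> 0 < C ->
  DeltaV_Lp_bounded q C -> exists2 C', 0 < C' & DeltaV_Lp_bounded p C'.
Proof.
move=> p1 conj_pq C0 boundedC; have p0 : 0 < p by lra.
have [q0 qE] := conjugate_exponent p1 conj_pq.
have e0 : 0 < (2 * C)^-1 by rewrite invr_gt0 mulr_gt0.
have [K K0 young] := powR_young p0 q0 conj_pq e0.
exists (2 * K) => [|n f fi fpi]; first exact: mulr_gt0.
pose g x := duality_map p (seg n) (DeltaV f x).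
have ag k : adapted (maxn n k) (g^~ k) by exact: adapted_duality_map_DeltaV.
have gi k : L1 (g^~ k) by exact: integrable_adapted (ag k).
have norm2_g : (fun x => norm2 (seg n) (g x) `^ q) =
    fun x => norm2 (seg n) (DeltaV f x) `^ p.
  by apply/funext => x; rewrite norm2_duality_map// -powRrM qE.
have := boundedC n g gi; rewrite norm2_g.
move=> /(_ (integrable_norm2_DeltaV_powR _ _ _))/(ler_wpM2l (ltW e0)).
have -> a : (2 * C)^-1 * (C * a) = 2^-1 * a by field; rewrite gt_eqF.
move=> absorbed.
have Tgi := integrable_norm2_DeltaV_powR n g q.
have Kfi := integrableZl_EFin K fpi.
have eTgi := integrableZl_EFin (2 * C)^-1 Tgi.
have : \int[mu]_x (norm2 (seg n) (DeltaV f x) `^ p) <=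
    \int[mu]_x (K * norm2 (seg n) (f x) `^ p +
                (2 * C)^-1 * norm2 (seg n) (DeltaV g x) `^ q).
  under eq_Rintegral do rewrite -dot_duality_map//.
  rewrite (Rintegral_DeltaV_selfadjoint (g := g) _ fi) => [|k]; last first.
    by exists (maxn n k).
  apply: (le_Rintegral measurableT).
  - apply: (integrable_sum_EFin _ (h := fun k x => f x k * DeltaV g x k)) => k.
    exact: integrableM_adapted (fi k) (@adapted_Delta k _).
  - exact: integrableD_EFin Kfi eTgi.
  - by move=> x _; apply: le_trans (cauchy_schwarz _ _ _) _; exact: young.
rewrite (RintegralD measurableT Kfi eTgi).
rewrite (RintegralZl K measurableT fpi) (RintegralZl _ measurableT Tgi).
have half_le (a b c : R) : a <= b + c -> c <= 2^-1 * a -> a <= 2 * b.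
  by clear; lra.
by move=> /half_le bound; rewrite -[leRHS]mulrA; exact: bound absorbed.
Qed.

Lemma DeltaV_Lp_bounded_gt1 (p : R) : 1 < p ->
  exists2 C, 0 < C & DeltaV_Lp_bounded p C.
Proof.
move=> p1; have [/DeltaV_Lp_bounded_ge2//|p2] := leP 2 p.
have p10 : 0 < p - 1 by rewrite subr_gt0.
have [C C0 boundedC] : exists2 C, 0 < C & DeltaV_Lp_bounded (p / (p - 1)) C.
  by apply: DeltaV_Lp_bounded_ge2; rewrite ler_pdivlMr//; lra.
apply: DeltaV_Lp_bounded_dual boundedC => //.
by field; rewrite !gt_eqF//; lra.
Qed.

(** * Truncated integrals and principal values *)

Lemma integrable_indic_cylinderM n x h : L1 h ->
  L1 (fun y => \1_(cylinder n emptyG) y * h (addG x y)).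
Proof.
by move=> hi; apply: integrable_indicM => //; exact: integrable_addG.
Qed.

Lemma Rintegral_indic_cylinderM n x h : L1 h ->
  \int[mu]_y (\1_(cylinder n emptyG) y * h (addG x y)) =
  \int[mu]_(y in cylinder n x) h y.
Proof.
move=> hi; rewrite -[RHS]Rintegral_indicM -[RHS](Rintegral_addG x); last first.
  exact: integrable_indicM.
by apply: eq_Rintegral => y _; rewrite indic_cylinder_addG.
Qed.

Lemma kappaM_translateE n x h : (fun y => kappa R n y * h (addG x y)) =
  if n is m.+1 then fun y =>
    2 ^+ n * (\1_(cylinder n emptyG) y * h (addG x y)) -
    2 ^+ m * (\1_(cylinder m emptyG) y * h (addG x y))
  else h \o addG x.
Proof.
apply/funext => y; case: n => [|n]; first by rewrite mul1r.
by rewrite kappaE mulrBl !mulrA.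
Qed.

Lemma integrable_kappaM n x h : L1 h ->
  L1 (fun y => kappa R n y * h (addG x y)).
Proof.
move=> hi; rewrite kappaM_translateE.
case: n => [|n]; first exact: integrable_addG.
by apply: integrableB_EFin; apply: integrableZl_EFin;
  exact: integrable_indic_cylinderM.
Qed.

Lemma convG_kappa n h x : L1 h -> convG mu (kappa R n) h x = Delta n h x.
Proof.
move=> hi; transitivity (\int[mu]_y (kappa R n y * h (addG x y))) => //.
rewrite kappaM_translateE; case: n => [|n] /=.
  by rewrite avg0; exact: Rintegral_addG.
have indi m := integrable_indic_cylinderM m x hi.
rewrite RintegralB ?RintegralZl ?Rintegral_indic_cylinderM//;
  exact: integrableZl_EFin.
Qed.

Definition ball_part N f (x : G) : nat -> R :=
  fun n => 2 ^+ n.-1 * \int[mu]_(y in cylinder N x) f y n.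

Definition truncV N f (x : G) : nat -> R :=
  fun n => if (n <= N)%N then DeltaV f x n - ball_part N f x n else 0.

Lemma truncK_cylinder f x (r : R) N : (forall k, L1 (f^~ k)) ->
  ballG emptyG r = cylinder N emptyG -> Defs.truncK mu f x r = truncV N f x.
Proof.
move=> fi rN; apply/funext => n; rewrite /Defs.truncK rN.
transitivity (\int[mu]_(y in ~` cylinder N emptyG)
    (kappa R n y * f (addG x y) n)) => //.
rewrite Rintegral_mkcond.
transitivity (\int[mu]_y
    (kappa R n \_ (~` cylinder N emptyG) y * f (addG x y) n)).
  by apply: eq_Rintegral => y _; rewrite !patchE; case: ifP; rewrite ?mul0r.
under eq_Rintegral do rewrite kappa_outside_cylinder.
rewrite /truncV; case: leqP => nN; last first.
  by under eq_Rintegral do rewrite mul0r; exact: Rintegral_cst_prob.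
under eq_Rintegral do rewrite mulrBl -mulrA.
have indi := integrable_indic_cylinderM N x (fi n).
rewrite RintegralB//; last 2 first.
- exact: integrable_kappaM (fi n).
- exact: integrableZl_EFin.
rewrite RintegralZl//; congr (_ - _ * _); first exact: convG_kappa (fi n).
exact: Rintegral_indic_cylinderM (fi n).
Qed.

Lemma Rintegral_cylinder_cvg0 x h : L1 h ->
  (fun N => \int[mu]_(y in cylinder N x) h y) @ \oo --> (0 : R).
Proof.
move=> hi; apply/cvgrPdist_lt => e e0.
have [r [r0 int_small]] := integral_normr_continuous hi e0.
have /cvgrPdist_lt/(_ r r0) := @cvg_invr_exp2 R.
apply: filterS => N; rewrite !sub0r !normrN ger0_norm// => Nr.
apply: le_lt_trans (int_small (cylinder N x) _ _) => //.
  by apply: le_normr_Rintegral => //; exact: integrable_cylinder.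
by rewrite mu_cylinder lte_fin.
Qed.

Section principal_value.
Variable f : G -> nat -> R.
Hypothesis fi : forall k, L1 (f^~ k).

Lemma ball_part_cvg0 x n : (fun N => ball_part N f x n) @ \oo --> (0 : R).
Proof.
rewrite -[X in _ --> X](mulr0 (2 ^+ n.-1)).
exact: cvgMr (Rintegral_cylinder_cvg0 x (fi n)).
Qed.

Lemma truncV_cvg x n : (fun N => truncV N f x n) @ \oo --> DeltaV f x n.
Proof.
apply: cvg_trans (_ : (fun N => DeltaV f x n - ball_part N f x n) @ \oo --> _).
  apply: near_eq_cvg; exists n => // N /= nN.
  by rewrite /truncV nN.
rewrite -[X in _ --> X]subr0; apply: cvgB; first exact: cvg_cst.
exact: ball_part_cvg0.
Qed.

Lemma PVlim_cylinderP x v : PVlim mu f x v <->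
  is_l2 v /\ (fun N => l2sq (fun n => truncV N f x n - v n)) @ \oo --> 0%E.
Proof.
split => -[v2 /ge0_cvge0P small]; split => //;
  apply/ge0_cvge0P => [?|e e0]; rewrite ?l2sq_ge0//.
  have [d /= d0 small_d] := small (fun r => l2sq_ge0 _) _ e0.
  have /cvgrPdist_lt/(_ d d0) := @cvg_invr_exp2 R.
  apply: filterS => N /small_d; rewrite invr_gt0 exprn_gt0//= => /(_ isT).
  by rewrite (truncK_cylinder _ fi (ballG_exp2 R N)).
have [M _ small_M] := small (fun N => l2sq_ge0 _) _ e0.
exists (2 ^+ M)^-1; first by rewrite /= invr_gt0 exprn_gt0.
move=> r /=; rewrite sub0r normrN => rM r0.
have [N MN rN] := ballG_cylinder r0 (le_lt_trans (ler_norm _) rM).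
by rewrite (truncK_cylinder _ fi rN); exact: small_M.
Qed.

Lemma PVlim_unique x v : PVlim mu f x v -> v = DeltaV f x.
Proof.
move=> /PVlim_cylinderP[_ /ge0_cvge0P small]; apply/funext => n.
suff cvg_v : (fun N => truncV N f x n) @ \oo --> v n.
  by rewrite -(cvg_lim _ cvg_v)//; apply: cvg_lim => //; exact: truncV_cvg.
apply/cvgrPdist_le => e e0.
have := small (fun N => l2sq_ge0 _) _ (exprn_gt0 2 e0).
apply: filterS => N /(le_trans (sqr_le_l2sq _ n)); rewrite lee_fin distrC.
by rewrite -[_ ^+ 2](real_normK (num_real _)) ler_sqr// nnegrE ltW.
Qed.

Lemma PVexistsP x : PVexists mu f x <-> PVlim mu f x (DeltaV f x).
Proof.
split=> [[v xv]|]; last by exists (DeltaV f x).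
by rewrite -(PVlim_unique xv).
Qed.

Lemma PVKE x :
  PVK mu f x = if `[< PVexists mu f x >] then DeltaV f x else fun=> 0.
Proof.
rewrite /PVK; case: pselect => [ex|nex]; last by rewrite asboolF.
by rewrite asboolT//; case: cid => v /= /PVlim_unique.
Qed.

Lemma l2sq_PVK_le x : (l2sq (PVK mu f x) <= l2sq (DeltaV f x))%E.
Proof.
rewrite PVKE; case: ifP => // _.
by apply: le_l2sq => k; rewrite expr0n sqr_ge0.
Qed.

Definition trunc_error N x : \bar R :=
  l2sq (fun n => truncV N f x n - DeltaV f x n).

Lemma trunc_errorE N x : trunc_error N x =
  ((sqnorm (seg N.+1) (ball_part N f x))%:E + l2sq (tail N.+1 (DeltaV f x)))%E.
Proof.
rewrite /trunc_error (l2sq_split N.+1); congr (_%:E + _)%E.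
  apply: eq_big_nat => k /andP[_]; rewrite ltnS /truncV => ->.
  by rewrite addrAC subrr sub0r sqrrN.
rewrite !l2sq_tail eseries_cond [RHS]eseries_cond.
by apply: eq_eseriesr => k /= Nk; rewrite /truncV leqNgt Nk sub0r sqrrN.
Qed.

Lemma PVexists_limsupP x : PVexists mu f x <->
  is_l2 (DeltaV f x) /\ (limn_esup (trunc_error ^~ x) <= 0)%E.
Proof.
rewrite PVexistsP PVlim_cylinderP; split => -[x2 errx]; split => //.
  by rewrite (cvg_limn_einf_sup errx).2.
by apply: limn_esup_le_cvg => // N; exact: l2sq_ge0.
Qed.

Lemma measurable_DeltaV n : measurable_fun setT (fun x => DeltaV f x n).
Proof. exact: adapted_measurable (@adapted_DeltaV n f n (leqnn n)). Qed.

Lemma measurable_trunc_error N : measurable_fun setT (trunc_error N).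
Proof.
apply: measurable_l2sq => n; apply: measurable_funB (measurable_DeltaV n).
rewrite /truncV; case: (n <= N)%N => //.
apply: measurable_funB (measurable_DeltaV n) _.
apply: (@adapted_measurable _ _ N) => x y xy.
by rewrite /ball_part (cylinder_eq xy).
Qed.

Lemma measurable_PVexists : measurable [set x | PVexists mu f x].
Proof.
rewrite (_ : mkset _ = [set x | (l2sq (DeltaV f x) < +oo)%E] `&`
    [set x | (limn_esup (trunc_error ^~ x) <= 0)%E]); last first.
  by apply/seteqP; split => x /PVexists_limsupP.
apply: measurableI; rewrite -[X in measurable X]setTI.
  apply: emeasurable_fun_infty_o => //.
  exact: measurable_l2sq measurable_DeltaV.
apply: emeasurable_fun_infty_c => //.
exact: measurable_fun_limn_esup measurable_trunc_error.
Qed.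

Lemma measV_PVK : measV (PVK mu f).
Proof.
move=> n; rewrite (_ : (fun x => _) = fun x =>
    if `[< PVexists mu f x >] then DeltaV f x n else 0); last first.
  by apply/funext => x; rewrite PVKE; case: ifP.
apply: measurable_fun_ifT; last exact: measurable_cst.
  apply: (measurable_fun_bool true); rewrite setTI.
  rewrite (_ : _ @^-1` _ = [set x | PVexists mu f x]).
    exact: measurable_PVexists.
  by apply/seteqP; split => x /asboolP.
exact: measurable_DeltaV.
Qed.

End principal_value.

(** * Almost everywhere convergence *)

Lemma LpnormV1 f : LpnormV mu 1 f = (\int[mu]_x normV (f x))%E.
Proof.
rewrite /LpnormV invr1 poweRe1; last first.
  by apply: integral_ge0 => x _; exact: poweR_ge0.
by apply: eq_integral => x _; rewrite poweRe1// normV_ge0.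
Qed.

Lemma LpV_integrable f (p : R) : 0 < p -> LpV mu p f ->
  mu.-integrable setT (fun x => normV (f x) `^ p)%E.
Proof.
move=> p0 [mf fp]; apply/ge0_integrableP => [x|]; first exact: poweR_ge0.
split; first exact: measurable_normV_poweR.
by apply: lty_poweRy fp; rewrite invr_eq0 gt_eqF.
Qed.

Lemma LpV1_integrableP f :
  LpV mu 1 f <-> measV f /\ mu.-integrable setT (fun x => normV (f x)).
Proof.
have normV_int := ge0_integrableP mu (fun x => normV_ge0 (f x)).
split=> [[mf fp]|[mf /normV_int[_ f_oo]]].
  by split => //; apply/normV_int; rewrite -LpnormV1; split => //;
    exact: measurable_normV.
by split => //; rewrite LpnormV1.
Qed.

Lemma LpV_LpV1 f (p : R) : 1 <= p -> LpV mu p f -> LpV mu 1 f.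
Proof.
move=> p1 fp; have [mf _] := fp; apply/LpV1_integrableP; split => //.
have := LpV_integrable (lt_le_trans ltr01 p1) fp.
move=> /(integrableD measurableT (integrable_cst_prob 1)).
apply: le_integrable => //; first exact: measurable_normV.
move=> x _; rewrite !gee0_abs ?normV_ge0 ?adde_ge0 ?poweR_ge0//.
exact: lee_1D_poweR (normV_ge0 _).
Qed.

Lemma LpV1_integrable_coord f k : LpV mu 1 f -> L1 (f^~ k).
Proof.
move=> /LpV1_integrableP[mf]; apply: le_integrable => //.
  by apply/measurable_EFinP; exact: mf.
by move=> x _ /=; rewrite [leRHS]gee0_abs ?normV_ge0//; exact: normr_le_normV.
Qed.

Lemma LpV_integrable_norm2 f (p : R) n : 0 < p -> LpV mu p f ->
  L1 (fun x => norm2 (seg n) (f x) `^ p).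
Proof.
move=> p0 fp; have [mf _] := fp.
apply: le_integrable (LpV_integrable p0 fp) => //.
  apply/measurable_EFinP.
  exact: (measurableT_comp (measurable_powR p) (measurable_norm2 mf _)).
move=> x _ /=; rewrite ger0_norm ?powR_ge0// [leRHS]gee0_abs ?poweR_ge0//.
exact: norm2_powR_le_normV (ltW p0).
Qed.

Lemma Rintegral_norm2_powR_le_normV f (p : R) n : 0 < p -> LpV mu p f ->
  ((\int[mu]_x (norm2 (seg n) (f x) `^ p))%:E <=
   \int[mu]_x (normV (f x) `^ p))%E.
Proof.
move=> p0 fp; have [mf _] := fp; have fpi := LpV_integrable_norm2 n p0 fp.
rewrite (EFin_Rintegral fpi); apply: ge0_le_integral => //.
- by move=> x _; rewrite lee_fin powR_ge0.
- exact: measurable_int fpi.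
- exact: measurable_normV_poweR.
- by move=> x _; exact: norm2_powR_le_normV (ltW p0).
Qed.

Lemma Rintegral_norm2_le_LpnormV1 f n : LpV mu 1 f ->
  ((\int[mu]_x norm2 (seg n) (f x))%:E <= LpnormV mu 1 f)%E.
Proof.
move=> f1; have := Rintegral_norm2_powR_le_normV n ltr01 f1.
rewrite (_ : (fun x => _ `^ 1) = fun x => norm2 (seg n) (f x)).
  rewrite /LpnormV invr1 poweRe1//.
  by apply: integral_ge0 => x _; exact: poweR_ge0.
by apply/funext => x; rewrite powRr1.
Qed.

Lemma weak_type_DeltaV f (l : R) : LpV mu 1 f -> 0 < l ->
  (l%:E * mu [set x | (l%:E < normV (DeltaV f x))%E] <=
   2%:E * LpnormV mu 1 f)%E.
Proof.
move=> f1 l0; have fi k := LpV1_integrable_coord k f1.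
rewrite muleC -lee_pdivlMr// lt_normV_bigcup.
pose A n := [set x | l < norm2 (seg n) (DeltaV f x)].
pose S n := [set x | l ^+ 2 <= quadvar (seg n) f n x].
have mA n : measurable (A n).
  rewrite (_ : A n = [set x |
      (l%:E < (norm2 (seg n) (DeltaV f x))%:E)%E]) //.
  rewrite -[X in measurable X]setTI; apply: emeasurable_fun_o_infty => //.
  by apply/measurable_EFinP/measurable_norm2 => k; exact: measurable_DeltaV.
have mS n : measurable (S n).
  exact: adapted_measurable_set
    (adapted_comp (fun y => l ^+ 2 <= y) (@adapted_quadvar (seg n) f n)).
have A_nd n : A n `<=` A n.+1.
  by move=> x /lt_le_trans; apply; rewrite ler_wsqrtr// sqnorm_iotaS.
have A_sub_S n : A n `<=` S n.
  move=> x; rewrite /A/= ltNge norm2_le_sqr ?(ltW l0)// -ltNge => /ltW.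
  by move=> /le_trans; apply; exact: sqnorm_DeltaV_le.
apply: measure_bigcup_le => // n; rewrite lee_pdivlMr// muleC.
apply: (@le_trans _ _ (l%:E * mu (S n)))%E.
  by rewrite lee_pmul2l//; exact: subset_le_measure (mA n) (mS n) (A_sub_S n).
rewrite -[mu (S n)]fineK ?fin_num_mu// -EFinM.
apply: (@le_trans _ _ (2 * \int[mu]_x norm2 (seg n) (f x))%:E).
  by rewrite lee_fin; exact: weak_type_quadvar.
rewrite EFinM lee_pmul2l//; exact: Rintegral_norm2_le_LpnormV1.
Qed.

Lemma DeltaV_l2_ae f : LpV mu 1 f -> {ae mu, forall x, is_l2 (DeltaV f x)}.
Proof.
move=> f1; have f_fin : LpnormV mu 1 f \is a fin_num.
  by rewrite ge0_fin_numE ?poweR_ge0//; case: f1.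
have := @weak_type_ae_lty _ _ _ mu (fun x => normV (DeltaV f x))
  (2 * fine (LpnormV mu 1 f)) (measurable_normV (measurable_DeltaV f)).
have weak l : 0 < l -> (l%:E * mu [set x | (l%:E < normV (DeltaV f x))%E] <=
    (2 * fine (LpnormV mu 1 f))%:E)%E.
  by rewrite EFinM fineK//; exact: weak_type_DeltaV.
by move=> /(_ weak); apply: filterS => x /is_l2P.
Qed.

Definition maximal_ge_upto h (l : R) N x : bool :=
  has (fun n => l <= avg n h x) (iota 0 N.+1).

Lemma adapted_maximal_ge_upto h (l : R) N : adapted N (maximal_ge_upto h l N).
Proof.
move=> x y xy; apply: eq_in_has => n; rewrite mem_iota add0n => /andP[_ nN].
by rewrite (adaptedW _ (@adapted_avg n h) xy).
Qed.

Lemma maximal_ge_uptoS h (l : R) N x :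
  maximal_ge_upto h l N.+1 x = maximal_ge_upto h l N x || (l <= avg N.+1 h x).
Proof.
by rewrite /maximal_ge_upto -[in LHS]addn1 iotaD has_cat /= add0n orbF.
Qed.

Lemma measurable_maximal_ge_upto h (l : R) N :
  measurable [set x | maximal_ge_upto h l N x].
Proof. exact: adapted_measurable_set (@adapted_maximal_ge_upto h l N). Qed.

Lemma dyadic_maximal_ineq_upto h (l : R) N : L1 h -> (forall x, 0 <= h x) ->
  l * fine (mu [set x | maximal_ge_upto h l N x]) <= \int[mu]_x h x.
Proof.
move=> hi h0; have aB m := @adapted_maximal_ge_upto h l m.
pose F m x := if maximal_ge_upto h l m x then l - avg m h x else 0.
have aF m : adapted m (F m).
  by move=> x y xy; rewrite /F (aB _ _ _ xy) (adapted_avg h xy).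
have intF_le0 : \int[mu]_x F N x <= 0.
  apply: le_trans (_ : F 0%N emptyG <= 0); last first.
    by rewrite /F /maximal_ge_upto /= orbF; case: ifP => //; lra.
  apply: supermartingale_Rintegral => // m x.
  rewrite /F !maximal_ge_uptoS (adapted_flip x (aB m) (leqnn m)).
  have := avg_midpoint m x hi.
  case: (maximal_ge_upto h l m x) => /=; first by lra.
  by move=> _; case: ifP; case: ifP; lra.
have mB := measurable_maximal_ge_upto h l N.
have Bi := integrable_indic_prob mB; have avgi := integrable_avg N h.
rewrite -(Rintegral_avg N hi) -(Rintegral_indic_prob mB) -RintegralZl//.
rewrite -subr_le0 -RintegralB//; last exact: integrableZl_EFin.
apply: le_trans intF_le0; apply: (le_Rintegral measurableT).
- by apply: integrableB_EFin => //; exact: integrableZl_EFin.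
- exact: integrable_adapted (aF N).
move=> x _; rewrite indic_pred /F; case: ifP => _; first by rewrite mulr1.
by rewrite mulr0 sub0r oppr_le0 avg_ge0.
Qed.

Definition maximal_ge h (l : R) : set G := [set x | exists n, l <= avg n h x].

Lemma maximal_geE h (l : R) :
  maximal_ge h l = \bigcup_N [set x | maximal_ge_upto h l N x].
Proof.
apply/seteqP; split => [x [n lx]|x [N _ /hasP[n _ lx]]]; last by exists n.
by exists n => //; apply/hasP; exists n; rewrite // mem_iota add0n ltnS leqnn.
Qed.

Lemma measurable_maximal_ge h (l : R) : measurable (maximal_ge h l).
Proof.
rewrite maximal_geE; apply: bigcupT_measurable => N.
exact: measurable_maximal_ge_upto.
Qed.

Lemma dyadic_maximal_ineq h (l : R) : L1 h -> (forall x, 0 <= h x) -> 0 < l ->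
  (l%:E * mu (maximal_ge h l) <= (\int[mu]_x h x)%:E)%E.
Proof.
move=> hi h0 l0; have mB := measurable_maximal_ge_upto h l.
rewrite muleC -lee_pdivlMr// maximal_geE; apply: measure_bigcup_le => // N.
  by move=> x; rewrite /= maximal_ge_uptoS => ->.
rewrite lee_pdivlMr// muleC -[mu _]fineK ?fin_num_mu// -EFinM lee_fin.
exact: dyadic_maximal_ineq_upto.
Qed.

Definition tail_norm f M (x : G) : R := fine (normV (tail M (f x))).

Lemma tail_norm_ge0 f M x : 0 <= tail_norm f M x.
Proof. by rewrite fine_ge0// normV_ge0. Qed.

Lemma tail_norm_le f M x : ((tail_norm f M x)%:E <= normV (tail M (f x)))%E.
Proof.
rewrite /tail_norm; have := normV_ge0 (tail M (f x)).
by case: (normV _) => //= _; rewrite leey.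
Qed.

Section L1_tails.
Variable f : G -> nat -> R.
Hypothesis f1 : LpV mu 1 f.

Let fi k : L1 (f^~ k).
Proof. exact: LpV1_integrable_coord f1. Qed.

Lemma measurable_tail_norm M : measurable_fun setT (tail_norm f M).
Proof.
apply: measurableT_comp => //; apply: measurable_normV => k.
rewrite /tail; case: (M <= k)%N => //; exact: integrable_measurable (fi k).
Qed.

Lemma tail_norm_le_normV M x : (`|(tail_norm f M x)%:E| <= normV (f x))%E.
Proof.
rewrite gee0_abs ?lee_fin ?tail_norm_ge0//.
by apply: le_trans (tail_norm_le f M x) _; rewrite le_normV ?l2sq_tail_le.
Qed.

Lemma integrable_tail_norm M : L1 (tail_norm f M).
Proof.
have /LpV1_integrableP[_] := f1; apply: le_integrable => //.
  by apply/measurable_EFinP; exact: measurable_tail_norm.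
by move=> x _; rewrite [leRHS]gee0_abs ?normV_ge0// tail_norm_le_normV.
Qed.

Lemma LpV1_is_l2_ae : {ae mu, forall x, is_l2 (f x)}.
Proof.
have /LpV1_integrableP[_ /(integrable_ae measurableT)] := f1.
by apply: filterS => x /(_ I) fx; apply/is_l2P; rewrite ltey_eq fx.
Qed.

Lemma Rintegral_tail_norm_cvg0 :
  (fun M => \int[mu]_x tail_norm f M x) @ \oo --> (0 : R).
Proof.
have mt M : measurable_fun setT (EFin \o tail_norm f M).
  by apply/measurable_EFinP; exact: measurable_tail_norm.
have cvg_tail : {ae mu, forall x, [set: G] x ->
    (fun M => (tail_norm f M x)%:E) @ \oo --> 0%E}.
  apply: filterS LpV1_is_l2_ae => x /normV_tail_cvg0/ge0_cvge0P small _.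
  apply/ge0_cvge0P => [M|e e0]; first by rewrite lee_fin tail_norm_ge0.
  apply: filterS (small (fun M => normV_ge0 _) _ e0) => M.
  exact: le_trans (tail_norm_le f M x).
have bound : {ae mu, forall x M, [set: G] x ->
    (`|(EFin \o tail_norm f M) x| <= normV (f x))%E}.
  by apply: aeW => x M _; exact: tail_norm_le_normV.
have /LpV1_integrableP[_ f_int] := f1.
have [_ _] := dominated_convergence measurableT mt (measurable_cst 0%E)
  cvg_tail f_int bound.
by rewrite integral0 => /fine_cvg.
Qed.

Lemma negligible_maximal_ge_tail l : 0 < l ->
  mu.-negligible (\bigcap_M maximal_ge (tail_norm f M) l).
Proof.
move=> l0; have mA M := measurable_maximal_ge (tail_norm f M) l.
apply/negligibleP; first exact: bigcapT_measurable.
apply/eqP; rewrite eq_le measure_ge0 andbT; apply/lee_addgt0Pr => e e0.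
have le0 : 0 < l * e by rewrite mulr_gt0.
have /cvgrPdist_le/(_ _ le0)[M _ /(_ M (leqnn M)) /=] :=
  Rintegral_tail_norm_cvg0.
rewrite sub0r normrN ger0_norm ?Rintegral_ge0// => [small|x _]; last first.
  exact: tail_norm_ge0.
rewrite add0e -(@lee_pmul2l _ l%:E)//.
apply: (@le_trans _ _ (l%:E * mu (maximal_ge (tail_norm f M) l)))%E.
  rewrite lee_pmul2l//; apply: subset_le_measure => //.
    exact: bigcapT_measurable.
  by move=> x; apply.
apply: le_trans (dyadic_maximal_ineq (integrable_tail_norm M) _ l0) _.
  exact: tail_norm_ge0.
by rewrite lee_fin.
Qed.

Lemma ae_tail_maximal_lt : {ae mu, forall x, forall l, 0 < l ->
  exists M, forall n, avg n (tail_norm f M) x < l}.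
Proof.
have : {ae mu, forall x (j : nat),
    ~ (\bigcap_M maximal_ge (tail_norm f M) j.+1%:R^-1) x}.
  apply/ae_foralln => j.
  apply: negligibleS (negligible_maximal_ge_tail (_ : 0 < j.+1%:R^-1)).
    by move=> x /= /contrapT.
  by rewrite invr_gt0.
apply: filterS => x notin l l0.
have /cvgrPdist_lt/(_ _ l0)[j _ /(_ j (leqnn j)) /=] := @cvg_harmonic R.
rewrite sub0r normrN ger0_norm ?invr_ge0// => jl.
have [M not_ge] : exists M, ~ maximal_ge (tail_norm f M) j.+1%:R^-1 x.
  by apply: contrapT => /forallNP all_ge; apply: (notin j) => M _;
    apply: contrapT; exact: all_ge.
exists M => n; apply: lt_trans jl; rewrite ltNge; apply/negP => ge_n.
by apply: not_ge; exists n.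
Qed.

Lemma norm2_vavg_le_tail_norm M N n x :
  norm2 (index_iota M N) (vavg n f x) <= avg n (tail_norm f M) x.
Proof.
apply: le_trans (norm2_vavg_le _ _ _ fi) _; apply: ae_le_avg.
- exact: integrable_norm2 fi.
- exact: integrable_tail_norm.
apply: filterS LpV1_is_l2_ae => y y2; rewrite -lee_fin /tail_norm fineK.
  exact: norm2_le_normV_tail.
rewrite ge0_fin_numE ?normV_ge0//; apply/is_l2P.
exact: le_lt_trans (l2sq_tail_le M _) y2.
Qed.

Lemma sqnorm_ball_part_tail_le M N x :
  sqnorm (index_iota M N.+1) (ball_part N f x) <=
  avg N (tail_norm f M) x ^+ 2.
Proof.
rewrite -norm2_le_sqr; last by apply: avg_ge0; exact: tail_norm_ge0.
apply: le_trans (norm2_vavg_le_tail_norm M N.+1 N x); rewrite ler_wsqrtr//.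
apply: le_sqnorm => k; rewrite mem_index_iota ltnS => /andP[_ kN].
rewrite /ball_part /vavg /avg !normrM ler_wpM2r// !ger0_norm ?exprn_ge0//.
by rewrite ler_weXn2l ?ler1n// (leq_trans (leq_pred k)).
Qed.

Lemma sqnorm_ball_part_head_cvg0 M x :
  (fun N => sqnorm (seg M) (ball_part N f x)) @ \oo --> (0 : R).
Proof.
have -> : 0 = \sum_(0 <= k < M) 0 :> R by rewrite big1_eq.
apply: cvg_big => [|k _]; first exact: add_continuous.
rewrite -[X in _ --> X](mulr0 0).
by under eq_fun do rewrite expr2; apply: cvgM; exact: ball_part_cvg0.
Qed.

Lemma sqnorm_ball_part_cvg0 x :
  (forall l, 0 < l -> exists M, forall n, avg n (tail_norm f M) x < l) ->
  (fun N => sqnorm (seg N.+1) (ball_part N f x)) @ \oo --> (0 : R).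
Proof.
move=> tail_lt; apply/cvgrPdist_le => e e0.
have e2 : 0 < e / 2 by rewrite divr_gt0.
have [|M tail_M] := tail_lt (Num.sqrt (e / 2)); first by rewrite sqrtr_gt0.
have /cvgrPdist_le/(_ _ e2) := sqnorm_ball_part_head_cvg0 M x.
move=> [N0 _ head_small]; exists (maxn M N0) => // N /=.
rewrite geq_max => /andP[MN /head_small/=].
rewrite !sub0r !normrN !ger0_norm// => head_N.
rewrite /sqnorm (@big_cat_nat _ _ _ M)//=; last exact: leqW.
rewrite [leRHS]splitr lerD//.
apply: le_trans (sqnorm_ball_part_tail_le M N x) _.
rewrite -[leRHS]sqr_sqrtr ?(ltW e2)//.
rewrite ler_sqr ?nnegrE ?sqrtr_ge0 ?(ltW (tail_M N))//.
by apply: avg_ge0; exact: tail_norm_ge0.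
Qed.

Lemma PVexists_ae : {ae mu, forall x, PVexists mu f x}.
Proof.
move: (DeltaV_l2_ae f1) ae_tail_maximal_lt; apply: filterS2 => x x2 tail_lt.
apply/(PVexistsP fi)/(PVlim_cylinderP fi); split => //.
have -> : (fun N => l2sq (fun n => truncV N f x n - DeltaV f x n)) =
    fun N => ((sqnorm (seg N.+1) (ball_part N f x))%:E +
              l2sq (tail N.+1 (DeltaV f x)))%E.
  by apply/funext => N; exact: trunc_errorE.
rewrite -(adde0 0%E); apply: cvgeD => //.
  by apply/cvg_EFin; [exact: nearW|exact: sqnorm_ball_part_cvg0].
rewrite (cvg_shiftS (fun M => l2sq (tail M (DeltaV f x)))).
exact: l2sq_tail_cvg0.
Qed.

End L1_tails.

(** * Boundedness and orthogonality *)

Lemma integral_DeltaV_Lp_le (p : R) : 1 < p ->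
  exists2 C : R, 0 < C & forall f, LpV mu p f ->
    (\int[mu]_x (normV (DeltaV f x) `^ p) <=
     C%:E * \int[mu]_x (normV (f x) `^ p))%E.
Proof.
move=> p1; have p0 : 0 < p by exact: lt_trans p1.
have [C C0 boundedC] := DeltaV_Lp_bounded_gt1 p1; exists C => // f fp.
have fi k := LpV1_integrable_coord k (LpV_LpV1 (ltW p1) fp).
have fpi n := LpV_integrable_norm2 n p0 fp.
apply: integral_normV_poweR_le => // [k|n]; first exact: measurable_DeltaV.
rewrite -(EFin_Rintegral (integrable_norm2_DeltaV_powR n f p)).
apply: (@le_trans _ _ (C%:E *
    (\int[mu]_x (norm2 (seg n) (f x) `^ p))%:E)%E).
  by rewrite -EFinM lee_fin; exact: boundedC.
by rewrite lee_pmul2l//; exact: Rintegral_norm2_powR_le_normV.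
Qed.

Lemma normV_PVK_le f x : (forall k, L1 (f^~ k)) ->
  (normV (PVK mu f x) <= normV (DeltaV f x))%E.
Proof. by move=> fi; apply: le_normV; exact: l2sq_PVK_le. Qed.

Lemma PVK_Lp (p : R) : 1 < p -> exists C : R, 0 < C /\
  forall f, LpV mu p f -> LpV mu p (PVK mu f) /\
    (LpnormV mu p (PVK mu f) <= C%:E * LpnormV mu p f)%E.
Proof.
move=> p1; have p0 : 0 < p by exact: lt_trans p1.
have [C C0 boundC] := integral_DeltaV_Lp_le p1.
exists (C `^ p^-1); split => [|f fp]; first exact: powR_gt0.
have fi k := LpV1_integrable_coord k (LpV_LpV1 (ltW p1) fp).
have mPVK := measV_PVK fi.
have int_ge0 g : (0 <= \int[mu]_x (normV (g x) `^ p))%E.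
  by apply: integral_ge0 => x _; exact: poweR_ge0.
have le_norm : (LpnormV mu p (PVK mu f) <= (C `^ p^-1)%:E * LpnormV mu p f)%E.
  rewrite /LpnormV -poweR_EFin -poweRM ?lee_fin ?(ltW C0)//.
  apply: lee_poweR2r; rewrite ?invr_ge0 ?(ltW p0)//.
  apply: le_trans (boundC f fp); apply: ge0_le_integral => //.
  - by move=> x _; exact: poweR_ge0.
  - exact: measurable_normV_poweR.
  - exact: measurable_normV_poweR (measurable_DeltaV f) p.
  - by move=> x _; rewrite lee_poweR2r ?(ltW p0) ?normV_ge0 ?normV_PVK_le.
split => //; split => //; apply: le_lt_trans le_norm _.
by rewrite lte_mul_pinfty ?lee_fin ?powR_ge0//; case: fp.
Qed.

Lemma weak_type_PVK f : LpV mu 1 f ->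
  (weakL1V mu (PVK mu f) <= 2%:E * LpnormV mu 1 f)%E.
Proof.
move=> f1; have fi k := LpV1_integrable_coord k f1.
apply: ge_ereal_sup => _ [l /= l0 <-].
apply: le_trans (weak_type_DeltaV f1 l0); rewrite lee_pmul2l//.
have measurable_lt (g : G -> nat -> R) : measV g ->
    measurable [set x | (l%:E < normV (g x))%E].
  move=> mg; rewrite -[X in measurable X]setTI.
  by apply: emeasurable_fun_o_infty => //; exact: measurable_normV.
apply: subset_le_measure; first exact: measurable_lt (measV_PVK fi).
  exact: measurable_lt (measurable_DeltaV f).
by move=> x /= /lt_le_trans; apply; exact: normV_PVK_le.
Qed.

Lemma PVK_ae_eq_Delta f n : LpV mu 1 f ->
  {ae mu, forall x, PVK mu f x n = Delta n (f^~ n) x}.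
Proof.
move=> f1; have fi k := LpV1_integrable_coord k f1.
move: (PVexists_ae f1); apply: filterS => x ex.
by rewrite (PVKE fi) asboolT.
Qed.

Lemma PVK_H2delta f : LpV mu 2 f -> H2delta mu (PVK mu f).
Proof.
move=> f2; have f1 := LpV_LpV1 (ler1n R 2) f2.
have fi k := LpV1_integrable_coord k f1.
have [C [_ /(_ f f2)[PVK2 _]]] := PVK_Lp (ltr1n R 2).
have PVKi n := LpV1_integrable_coord n (LpV_LpV1 (ler1n R 2) PVK2).
split=> // n; have PVK_Delta := PVK_ae_eq_Delta n f1.
apply: filterS (PVK_Delta) => x PVKx.
rewrite convG_kappa// PVKx.
rewrite (ae_eq_Delta _ _ _ _ PVK_Delta) ?Delta_idem//.
- exact: integrable_measurable (PVKi n).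
- exact: integrable_measurable (integrable_Delta n _).
Qed.

(* [Delta n] is a self-adjoint projection, so [h - Delta n h] is orthogonal to
   its range. *)
Lemma integral_Delta_orthogonal n h u b : L1 h -> L1 b ->
  measurable_fun setT u -> {ae mu, forall x, u x = Delta n h x} ->
  {ae mu, forall x, Delta n b x = b x} ->
  (\int[mu]_x ((h x - u x) * b x)%:E = 0)%E.
Proof.
move=> hi bi meas_u uD bD; pose D m := @adapted_Delta n m.
have hDi := integrableM_adapted hi (D b).
have DDi := integrableM_adapted (integrable_Delta n h) (D b).
have [mh mb] := (integrable_measurable hi, integrable_measurable bi).
rewrite (ae_eq_integral (fun x =>
    (h x * Delta n b x - Delta n h x * Delta n b x)%:E))//; last 3 first.
- by apply/measurable_EFinP/measurable_funM => //; exact: measurable_funB.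
- exact: measurable_int (integrableB_EFin hDi DDi).
- by move: uD bD; apply: filterS2 => x -> <- _; rewrite mulrBl.
rewrite -(EFin_Rintegral (integrableB_EFin hDi DDi)) RintegralB//.
have [M DbM] := adapted_bounded (D b).
rewrite (Rintegral_Delta_selfadjoint n hi (adapted_measurable (D b)) DbM).
under [X in (_ - X)%:E]eq_Rintegral do rewrite Delta_idem//.
by rewrite subrr.
Qed.

Lemma integrable_l2sq f : LpV mu 2 f ->
  mu.-integrable setT (fun x => l2sq (f x)).
Proof.
move=> /(LpV_integrable (ltr0n R 2)); apply: eq_integrable => // x _.
by rewrite normV_poweR divff// poweRe1// l2sq_ge0.
Qed.

Lemma PVK_orthogonal f g : LpV mu 2 f -> H2delta mu g ->
  innerV mu (fun x n => f x n - PVK mu f x n) g = 0%E.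
Proof.
move=> f2 [g2 g_H2]; have [mf _] := f2; have [mg _] := g2.
have [PVK2 _] := PVK_H2delta f2; have [mPVK _] := PVK2.
have f1 := LpV_LpV1 (ler1n R 2) f2.
have gi k := LpV1_integrable_coord k (LpV_LpV1 (ler1n R 2) g2).
pose D x := (l2sq (f x) + l2sq (PVK mu f x) + l2sq (g x))%E.
apply: (@integral_eseries_eq0 _ _ _ _ _ D).
- by move=> n; apply: measurable_funM => //; exact: measurable_funB.
- by apply: integrableD => //; [apply: integrableD => //|];
    exact: integrable_l2sq.
- move=> N x; apply: le_trans (_ : _ <= (sqnorm (seg N) (f x) +
      sqnorm (seg N) (PVK mu f x) + sqnorm (seg N) (g x))%:E)%E _.
    by rewrite lee_fin sum_normrM_le_sqnorm.
  by rewrite !EFinD !leeD ?sqnorm_le_l2sq.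
move=> n; apply: (@integral_Delta_orthogonal n) => //.
- exact: LpV1_integrable_coord f1.
- exact: PVK_ae_eq_Delta.
- by have := g_H2 n; apply: filterS => x; rewrite convG_kappa.
Qed.

End haar_measure.

Theorem theorem4p10 (R : realType) (mu : {measure set G -> \bar R})
  (mu_prob : mu setT = 1%E)
  (mu_haar : forall (a : G) (A : set G), measurable A ->
               mu [set addG a y | y in A] = mu A) :
  (* on L^2(G, l^2), P.V.(K * f) = P f, the orthogonal projection onto
     iota(H^2(delta)) *)
  (forall f : G -> nat -> R, LpV mu 2 f ->
     {ae mu, forall x, PVexists mu f x} /\
     H2delta mu (PVK mu f) /\
     (forall g, H2delta mu g ->
        innerV mu (fun x n => f x n - PVK mu f x n) g = 0%E))
  /\
  (* on L^1(G, l^2): a.e. existence and weak type (1,1) *)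
  (exists C : R, 0 < C /\
     forall f : G -> nat -> R, LpV mu 1 f ->
       {ae mu, forall x, PVexists mu f x} /\
       measV (PVK mu f) /\
       (weakL1V mu (PVK mu f) <= C%:E * LpnormV mu 1 f)%E)
  /\
  (* boundedness on L^p(G, l^2), 1 < p < oo *)
  (forall p : R, 1 < p ->
     exists C : R, 0 < C /\
       forall f : G -> nat -> R, LpV mu p f ->
         LpV mu p (PVK mu f) /\
         (LpnormV mu p (PVK mu f) <= C%:E * LpnormV mu p f)%E).
Proof.
split; last split.
- move=> f f2; have f1 := LpV_LpV1 mu_prob (ler1n R 2) f2.
  split; first exact: PVexists_ae.
  by split; [exact: PVK_H2delta|move=> g; exact: PVK_orthogonal].
- exists 2; split => // f f1; split; first exact: PVexists_ae.
  split; last exact: weak_type_PVK.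
  apply: (measV_PVK mu_prob mu_haar) => k; exact: LpV1_integrable_coord f1.
- by move=> p p1; exact: PVK_Lp.
Qed.
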